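(* Let $X,Y$ be non-zero Banach spaces over $\mathbb K\in\{\mathbb R,\mathbb C\}$ and let $\alpha\in\{\varepsilon,\pi\}$. Then $X\widehat\otimes_\alpha Y$ is weak Hilbert if and only if one of the factors $X,Y$ is finite-dimensional and the other factor is weak Hilbert.
   Context: A Banach space $W$ is called weak Hilbert if there are constants $\delta\in(0,1]$ and $C\ge1$ such that every finite-dimensional subspace $E\subset W$ contains a subspace $F\subset E$ for which $\dim F\ge\delta\dim E$, $d(F,\ell_2^{\dim F})\le C$, and there is a bounded projection $P:W\to F$ with $\|P\|\le C$. Here $d(E,F)=\inf\{\|T\|\|T^{-1}\|: T:E\to F\text{ a linear isomorphism}\}$ is the Banach--Mazur distance. For Banach spaces $X,Y$ over $\mathbb K$, and $w=\sum_{j=1}^r x_j\otimes y_j$ in the algebraic tensor product $X\otimes Y$, the injective norm is $\|w\|_\varepsilon=\sup\{|\sum_{j} x^*(x_j)y^*(y_j)|: x^*\in B_{X^*},\,y^*\in B_{Y^*}\}$ and the projective norm is $\|w\|_\pi=\inf\{\sum_{j}\|x_j\|\|y_j\|: w=\sum_{j} x_j\otimes y_j\}$. For $\alpha\in\{\varepsilon,\pi\}$, $X\widehat\otimes_\alpha Y$ is the completion of $X\otimes Y$ for $\|\cdot\|_\alpha$. *)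

(* Defs.v *)
From HB Require Import structures.
From mathcomp Require Import all_boot all_order all_algebra.
From mathcomp Require Import sesquilinear generic_quotient complex.
From mathcomp Require Import all_classical all_reals all_analysis.

Set Implicit Arguments.
Unset Strict Implicit.
Unset Printing Implicit Defensive.
Import Order.TTheory GRing.Theory Num.Theory.
Import numFieldNormedType.Exports.
Local Open Scope classical_set_scope.
Local Open Scope ring_scope.
Local Open Scope quotient_scope.

Inductive scalar_kind := RealScalars | ComplexScalars.

Definition scalars (R : realType) (k : scalar_kind) : numFieldType :=
  match k with
  | RealScalars => R
  | ComplexScalars => R[i]
  end.

Definition real_part (R : realType) (k : scalar_kind) : scalars R k -> R :=
  match k with
  | RealScalars => fun a => a
  | ComplexScalars => fun a => complex.Re a
  end.

(* The library's norm on a normed module over K takes its values in K, so over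
   R[i] it is a complex number with zero imaginary part; rnorm is the same norm
   with values in R. *)
Definition rnorm (R : realType) (k : scalar_kind)
    (V : normedZmodType (scalars R k)) (v : V) : R :=
  real_part `|v|.

Section AlgebraicTensor.
Variables (K : fieldType) (X Y : lmodType K).

(* A list of pairs [:: (x_1, y_1); ...; (x_r, y_r)] stands for the sum of the
   x_j (x) y_j.  Two lists give the same tensor when every bilinear map sends
   them to the same vector. *)
Definition bilin_sum (V : lmodType K) (b : X -> Y -> V) (s : seq (X * Y)) : V :=
  \sum_(p <- s) b p.1 p.2.

Definition same_tensor (s t : seq (X * Y)) : bool :=
  `[< forall (V : lmodType K) (b : {bilinear X -> Y -> V}),
        bilin_sum b s = bilin_sum b t >].

Lemma same_tensor_refl : reflexive same_tensor.
Proof. by move=> s; apply/asboolP. Qed.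

Lemma same_tensor_sym : symmetric same_tensor.
Proof. by move=> s t; apply/asboolP/asboolP => h V b; rewrite h. Qed.

Lemma same_tensor_trans : transitive same_tensor.
Proof.
by move=> s t u /asboolP h1 /asboolP h2; apply/asboolP => V b; rewrite h1 h2.
Qed.

Canonical same_tensor_equiv :=
  EquivRel same_tensor same_tensor_refl same_tensor_sym same_tensor_trans.

Definition tensor := {eq_quot same_tensor}.
HB.instance Definition _ := Choice.on tensor.
HB.instance Definition _ := Quotient.on tensor.
HB.instance Definition _ := EqQuotient.on tensor.

Definition tensor_class (s : seq (X * Y)) : tensor := \pi_tensor s.

Lemma tensor_classP (s t : seq (X * Y)) :
  tensor_class s = tensor_class t <->
  forall (V : lmodType K) (b : {bilinear X -> Y -> V}),
    bilin_sum b s = bilin_sum b t.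
Proof.
split=> [/eqP|h]; first by rewrite /tensor_class eqmodE => /asboolP.
by apply/eqP; rewrite /tensor_class eqmodE; apply/asboolP.
Qed.

Lemma tensor_reprK (w : tensor) : tensor_class (repr w) = w.
Proof. exact: reprK. Qed.

Lemma bilin_sum_repr (V : lmodType K) (b : {bilinear X -> Y -> V}) s :
  bilin_sum b (repr (tensor_class s)) = bilin_sum b s.
Proof. by move: V b; apply/tensor_classP; rewrite tensor_reprK. Qed.

Definition scale_seq (a : K) (s : seq (X * Y)) := [seq (a *: p.1, p.2) | p <- s].

Lemma bilin_sum_nil (V : lmodType K) (b : X -> Y -> V) : bilin_sum b [::] = 0.
Proof. by rewrite /bilin_sum big_nil. Qed.

Lemma bilin_sum_cat (V : lmodType K) (b : X -> Y -> V) s t :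
  bilin_sum b (s ++ t) = bilin_sum b s + bilin_sum b t.
Proof. by rewrite /bilin_sum big_cat. Qed.

Lemma bilin_sum_scale (V : lmodType K) (b : {bilinear X -> Y -> V}) a s :
  bilin_sum b (scale_seq a s) = a *: bilin_sum b s.
Proof.
rewrite /bilin_sum big_map scaler_sumr; apply: eq_bigr => p _ /=.
by rewrite linearZl_LR.
Qed.

Definition tensor0 : tensor := tensor_class [::].
Definition tensor_add (u v : tensor) : tensor :=
  tensor_class (repr u ++ repr v).
Definition tensor_scale (a : K) (u : tensor) : tensor :=
  tensor_class (scale_seq a (repr u)).
Definition tensor_opp (u : tensor) : tensor := tensor_scale (- 1) u.

Let bsE := (bilin_sum_repr, bilin_sum_cat, bilin_sum_scale, bilin_sum_nil).

Lemma tensor_addA : associative tensor_add.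
Proof. by move=> u v w; apply/tensor_classP => V b; rewrite !bsE addrA. Qed.

Lemma tensor_addC : commutative tensor_add.
Proof. by move=> u v; apply/tensor_classP => V b; rewrite !bsE addrC. Qed.

Lemma tensor_add0 : left_id tensor0 tensor_add.
Proof.
move=> u; rewrite -[RHS]tensor_reprK.
by apply/tensor_classP => V b; rewrite !bsE add0r.
Qed.

Lemma tensor_addN : left_inverse tensor0 tensor_opp tensor_add.
Proof.
by move=> u; apply/tensor_classP => V b; rewrite !bsE scaleN1r addNr.
Qed.

HB.instance Definition _ := GRing.isZmodule.Build tensor
  tensor_addA tensor_addC tensor_add0 tensor_addN.

Lemma tensor_scaleA a b (u : tensor) :
  tensor_scale a (tensor_scale b u) = tensor_scale (a * b) u.
Proof. by apply/tensor_classP => V f; rewrite !bsE scalerA. Qed.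

Lemma tensor_scale1 : left_id 1 tensor_scale.
Proof.
move=> u; rewrite -[RHS]tensor_reprK.
by apply/tensor_classP => V b; rewrite !bsE scale1r.
Qed.

Lemma tensor_scaleDr : right_distributive tensor_scale +%R.
Proof. by move=> a u v; apply/tensor_classP => V b; rewrite !bsE scalerDr. Qed.

Lemma tensor_scaleDl (u : tensor) :
  {morph tensor_scale^~ u : a b / a + b}.
Proof. by move=> a c; apply/tensor_classP => V b; rewrite !bsE scalerDl. Qed.

HB.instance Definition _ := GRing.Zmodule_isLmodule.Build K tensor
  tensor_scaleA tensor_scale1 tensor_scaleDr tensor_scaleDl.

Definition pure (x : X) (y : Y) : tensor := tensor_class [:: (x, y)].

Lemma pure_bilinear : bilinear_for *:%R *:%R pure.
Proof.
split=> [y a x x'|x a y y']; apply/tensor_classP => V b;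
  rewrite !bsE /bilin_sum !big_seq1 /=.
  by rewrite linearPl.
by rewrite linearPr.
Qed.

HB.instance Definition _ :=
  bilinear_isBilinear.Build K X Y tensor *:%R *:%R pure pure_bilinear.

Lemma tensor_class_sum s : tensor_class s = \sum_(p <- s) pure p.1 p.2.
Proof.
elim: s => [|[x y] s IHs]; first by rewrite big_nil.
rewrite big_cons -IHs; apply/tensor_classP => V b.
by rewrite !bsE -bilin_sum_cat.
Qed.

Lemma tensor_universal (V : lmodType K) (b : {bilinear X -> Y -> V}) :
  exists! f : tensor -> V,
    linear f /\ forall x y, f (pure x y) = b x y.
Proof.
exists (fun w => bilin_sum b (repr w)); split.
  split=> [a u v|x y]; first by rewrite !bsE.
  by rewrite !bsE /bilin_sum big_seq1.
move=> f [flin fpure]; apply: funext => w.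
pose g := GRing.isLinear.Build _ _ _ _ f flin.
pose F : {linear tensor -> V} := HB.pack f g.
rewrite -[in RHS](tensor_reprK w) tensor_class_sum -[f]/(F : _ -> _) linear_sum.
by apply: eq_bigr => p _; rewrite /= fpure.
Qed.

End AlgebraicTensor.

Section BanachSpaces.
Variables (R : realType) (k : scalar_kind).
Local Notation K := (scalars R k).

(* Norm of T as a map from the subspace A, normed by N, to a space normed by M. *)
Definition opnorm (V W : Type) (A : set V) (N : V -> R) (M : W -> R)
    (T : V -> W) : \bar R :=
  ereal_sup [set (M (T x))%:E | x in A `&` [set x | N x <= 1]].

Definition linear_on (V W : lmodType K) (A : set V) (T : V -> W) : Prop :=
  forall (a : K) x y, A x -> A y -> T (a *: x + y) = a *: T x + T y.

(* Subspaces are sets of an ambient space; only the values of T on A and of S on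
   B matter, and there they are mutually inverse linear isomorphisms. *)
Definition banach_mazur (V W : lmodType K) (A : set V) (N : V -> R)
    (B : set W) (M : W -> R) : \bar R :=
  ereal_inf [set d | exists (T : V -> W) (S : W -> V),
    [/\ linear_on A T /\ linear_on B S,
        (forall x, A x -> B (T x)) /\ (forall y, B y -> A (S y)),
        (forall x, A x -> S (T x) = x) /\ (forall y, B y -> T (S y) = y) &
        d = (opnorm A N M T * opnorm B M N S)%E]].

Definition has_dim (V : lmodType K) (E : set V) (n : nat) : Prop :=
  exists e : 'I_n -> V,
    (forall c : 'I_n -> K, \sum_i c i *: e i = 0 -> forall i, c i = 0) /\
    E = [set \sum_i c i *: e i | c in [set: 'I_n -> K]].

Definition finite_dimensional (V : lmodType K) : Prop :=
  exists n, has_dim [set: V] n.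

Definition l2norm (n : nat) (v : 'rV[K]_n) : R :=
  Num.sqrt (\sum_(i < n) rnorm (v 0 i) ^+ 2).

Definition weak_hilbert (W : normedModType K) : Prop :=
  exists delta C : R, [/\ 0 < delta, delta <= 1, 1 <= C &
    forall (E : set W) (n : nat), has_dim E n ->
      exists (F : set W) (m : nat),
        [/\ has_dim F m, F `<=` E, delta * n%:R <= m%:R,
            (banach_mazur F (@rnorm R k W) [set: 'rV[K]_m] (@l2norm m)
               <= C%:E)%E &
            exists P : {linear W -> W},
              [/\ forall x, F (P x), forall x, F x -> P x = x &
                  (opnorm [set: W] (@rnorm R k W) (@rnorm R k W) P
                     <= C%:E)%E]]].

Definition dual_ball (X : normedModType K) : set {linear X -> K^o} :=
  [set f | (opnorm [set: X] (@rnorm R k X) (@rnorm R k K^o) f <= 1)%E].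

Definition injective_norm (X Y : normedModType K) (w : tensor X Y) : \bar R :=
  ereal_sup [set r | exists (f : {linear X -> K^o}) (g : {linear Y -> K^o}),
    [/\ dual_ball f, dual_ball g &
        r = (rnorm (\sum_(p <- repr w) f p.1 * g p.2 : K^o))%:E]].

Definition projective_norm (X Y : normedModType K) (w : tensor X Y) : \bar R :=
  ereal_inf [set (\sum_(p <- s) rnorm p.1 * rnorm p.2)%:E |
              s in [set s | w = \sum_(p <- s) pure p.1 p.2]].

Inductive tensor_norm_kind := Injective | Projective.

Definition tensor_norm (alpha : tensor_norm_kind) (X Y : normedModType K) :
    tensor X Y -> \bar R :=
  match alpha with
  | Injective => @injective_norm X Y
  | Projective => @projective_norm X Y
  end.

(* Z, with the embedding iota, is a completion of (X (x) Y, ||.||_alpha); it is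
   unique up to linear isometry. *)
Definition is_completed_tensor (alpha : tensor_norm_kind)
    (X Y : normedModType K) (Z : completeNormedModType K)
    (iota : {linear tensor X Y -> Z}) : Prop :=
  (forall w, (rnorm (iota w))%:E = tensor_norm alpha w) /\ dense (range iota).

(* The value of f (x) g on a tensor does not depend on the representation. *)
Lemma functional_sum_repr (X Y : normedModType K) (f : {linear X -> K^o})
    (g : {linear Y -> K^o}) (s : seq (X * Y)) :
  \sum_(p <- repr (tensor_class s)) f p.1 * g p.2 =
  \sum_(p <- s) f p.1 * g p.2.
Proof.
have bb : bilinear_for *:%R *:%R (fun x y => f x * g y : K^o).
  split=> [y a x x'|x a y y'] /=; rewrite linearP /=.
    by rewrite mulrDl -scalerAl.
  by rewrite mulrDr -scalerAr.
pose B := bilinear_isBilinear.Build K X Y K^o *:%R *:%R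
  (fun x y => f x * g y : K^o) bb.
pose b : {bilinear X -> Y -> K^o} := HB.pack (fun x y => f x * g y : K^o) B.
exact: (bilin_sum_repr b).
Qed.

End BanachSpaces.

(* Main.v *)
Require Import Defs.
From HB Require Import structures.
From mathcomp Require Import all_boot all_order all_algebra.
From mathcomp Require Import sesquilinear complex.
From mathcomp Require Import all_classical all_reals all_analysis.
From mathcomp Require Import ring lra zify.
Set Implicit Arguments.
Unset Strict Implicit.
Unset Printing Implicit Defensive.
Import Order.TTheory GRing.Theory Num.Theory numFieldNormedType.Exports.
Local Open Scope classical_set_scope.
Local Open Scope ring_scope.

(** A space W is weak Hilbert exactly when every finite-dimensional subspace E
    contains, in a fixed proportion of its dimension, a space l2^m whose identity
    factors through W with uniform constants, the first factor taking values in E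
    ([weak_hilbertP]).  This form passes to subspaces, and both implications are
    proved in it.

    Suppose that the tensor product is weak Hilbert.  By the Hahn-Banach theorem
    ([hahn_banach]) X and Y embed into it as X (x) y0 and x0 (x) Y
    ([hilbert_factorization_factor]), so both are weak Hilbert.  If both were
    infinite-dimensional, each would contain uniformly complemented copies of l2^n
    for all n.  The diagonal tensors e_j (x) e_j of two such copies span an
    l_infty^n for the injective norm and an l_1^n for the projective norm, and a
    complemented l2^m in their span satisfies m = O(sqrt n)
    ([diagonal_l2_dimension]): the trace of the identity of l2^m is bounded by a
    product of two Hilbert-Schmidt norms, which are estimated coordinatewise and
    by a choice of signs.  This contradicts m >= delta n
    ([infinite_factors_contradiction]).

    Conversely, let X be finite-dimensional.  Bounded coordinates on X write the
    identity of the tensor product as a finite sum of a_i b_i through Y, and it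
    remains to see that a space whose identity is such a sum inherits the weak
    Hilbert property from Y ([hilbert_factorization_sum]).  Given E, successive
    subspaces of proportional dimension are chosen on which each b_i vanishes or is
    injective with complemented Euclidean image.  This produces several Euclidean
    norms on one space.  Diagonalising the difference of two Hermitian forms shows
    that one of two Euclidean norms dominates the other on half of the dimensions
    ([dominating_half]); with the dominating norm all b_i are bounded, and the
    subspace is complemented by means of the b_i it comes from. *)

(** * Scalars and real-valued norms *)

Section Scalars.
Variables (R : realType) (k : scalar_kind).
Local Notation K := (scalars R k).

Definition of_real : R -> K :=
  match k return R -> scalars R k with
  | RealScalars => fun r => r
  | ComplexScalars => fun r => (r%:C)%C
  end.

Definition conj : K -> K :=
  match k return scalars R k -> scalars R k with
  | RealScalars => fun a => a
  | ComplexScalars => fun a => (a^*)%C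
  end.

Fact of_real_zmod : zmod_morphism of_real.
Proof. by rewrite /of_real; case: k => a b //; rewrite rmorphB. Qed.

Fact of_real_monoid : monoid_morphism of_real.
Proof.
rewrite /of_real; split; case: k => // a b; exact: (rmorphM (real_complex R)).
Qed.

HB.instance Definition _ := GRing.isZmodMorphism.Build R K of_real of_real_zmod.
HB.instance Definition _ :=
  GRing.isMonoidMorphism.Build R K of_real of_real_monoid.

Fact conj_zmod : zmod_morphism conj.
Proof. by rewrite /conj; case: k => a b //; rewrite rmorphB. Qed.

Fact conj_monoid : monoid_morphism conj.
Proof.
rewrite /conj; split; first by case: k => //; exact: (rmorph1 (@conjc R)).
by case: k => // a b; exact: (rmorphM (@conjc R)).
Qed.

HB.instance Definition _ := GRing.isZmodMorphism.Build K K conj conj_zmod.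
HB.instance Definition _ := GRing.isMonoidMorphism.Build K K conj conj_monoid.

Fact real_part_zmod : zmod_morphism (@real_part R k).
Proof. by rewrite /real_part; case: k => a b //; rewrite raddfB. Qed.
HB.instance Definition _ :=
  GRing.isZmodMorphism.Build K R (@real_part R k) real_part_zmod.

Lemma conjK : involutive conj.
Proof. by rewrite /conj; case: k => // a; rewrite conjcK. Qed.

Lemma conj_of_real r : conj (of_real r) = of_real r.
Proof. by rewrite /conj /of_real; case: k => //; exact: conjc_real. Qed.

Lemma of_realK : cancel of_real (@real_part R k).
Proof. by rewrite /of_real /real_part; case: k. Qed.

Lemma real_partZ r a : real_part (of_real r * a) = r * real_part a.
Proof.
by rewrite /of_real /real_part; case: k a => // -[x y] /=; rewrite mul0r subr0.
Qed.

Lemma ler_of_real r s : (of_real r <= of_real s) = (r <= s).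
Proof. by rewrite /of_real; case: k => //; exact: lecR. Qed.

Lemma of_real_ge0_ex a : 0 <= a -> a = of_real (real_part a).
Proof.
rewrite /of_real /real_part; case: k a => //= -[x y] /=.
by rewrite lecE /= => /andP[/eqP -> _].
Qed.

(** The norm with values in the scalar field is the image of the real-valued one,
    so every property of the latter follows by injectivity or monotonicity of
    the embedding, without a case distinction on the scalars. *)
Lemma norm_rnorm (V : normedZmodType K) (v : V) : `|v| = of_real (rnorm v).
Proof. exact: of_real_ge0_ex. Qed.

Lemma rnorm_conj a : rnorm (conj a : K) = rnorm (a : K).
Proof.
rewrite /rnorm /conj; case: k a => // a.
suff E (z : R[i]) : complex.Re `|(z^*)%C| = complex.Re `|z| by exact: E.
by case: z => x y; rewrite !normc_def /= sqrrN.
Qed.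

Lemma mul_conj a : a * conj a = of_real (rnorm (a : K) ^+ 2).
Proof.
rewrite rmorphXn /= -norm_rnorm /conj; case: k a => a.
  by rewrite [RHS](@real_normK R) ?num_real.
by rewrite [RHS](@sqr_normc R).
Qed.

Lemma real_part_le a : `|real_part a| <= rnorm (a : K).
Proof.
rewrite /rnorm /real_part; case: k a => // a.
suff E (z : R[i]) : `|complex.Re z| <= complex.Re `|z| by exact: E.
by rewrite normc_def /= -sqrtr_sqr ler_wsqrtr // lerDl sqr_ge0.
Qed.

Lemma rnorm_of_real r : rnorm (of_real r : K) = `|r|.
Proof.
rewrite /rnorm /of_real /real_part; case: k => //.
suff E : complex.Re `|(r%:C)%C| = `|r| by exact: E.
by rewrite normc_def /= expr0n addr0 sqrtr_sqr.
Qed.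

Lemma of_real_inj : injective of_real.
Proof. exact: can_inj of_realK. Qed.

Section Norm.
Variable V : normedZmodType K.
Implicit Types v w : V.

Lemma rnorm_ge0 v : 0 <= rnorm v.
Proof. by rewrite -ler_of_real rmorph0 -norm_rnorm. Qed.

Lemma rnorm0 : rnorm (0 : V) = 0.
Proof. by apply: of_real_inj; rewrite rmorph0 -norm_rnorm normr0. Qed.

Lemma rnorm_eq0 v : rnorm v = 0 -> v = 0.
Proof. by move=> v0; apply/eqP; rewrite -normr_eq0 norm_rnorm v0 rmorph0. Qed.

Lemma rnormD v w : rnorm (v + w) <= rnorm v + rnorm w.
Proof. by rewrite -ler_of_real rmorphD /= -!norm_rnorm ler_normD. Qed.

Lemma rnormN v : rnorm (- v) = rnorm v.
Proof. by rewrite /rnorm normrN. Qed.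

Lemma rnorm_sum (I : Type) (s : seq I) (P : pred I) (F : I -> V) :
  rnorm (\sum_(i <- s | P i) F i) <= \sum_(i <- s | P i) rnorm (F i).
Proof.
elim/big_ind2: _ => [||//]; first by rewrite rnorm0.
by move=> x a y b xa yb; rewrite (le_trans (rnormD _ _)) ?lerD.
Qed.

End Norm.

Lemma rnorm1 : rnorm (1 : K) = 1.
Proof. by rewrite -(rmorph1 (of_real)) rnorm_of_real normr1. Qed.

Lemma ltr_of_real (r s : R) : (of_real r < of_real s) = (r < s).
Proof. by rewrite !lt_neqAle ler_of_real (inj_eq of_real_inj). Qed.

Lemma of_real_gt0_ex (e : K) : 0 < e -> exists2 r : R, 0 < r & e = of_real r.
Proof.
move=> e0; have eE := of_real_ge0_ex (ltW e0).
by exists (real_part e); rewrite // -ltr_of_real rmorph0 -eE.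
Qed.

Lemma rnormM (a b : K) : rnorm (a * b) = rnorm a * rnorm b.
Proof. by apply: of_real_inj; rewrite rmorphM /= -!norm_rnorm normrM. Qed.

Lemma rnormZ (V : normedModType K) a (v : V) :
  rnorm (a *: v) = rnorm (a : K) * rnorm v.
Proof. by apply: of_real_inj; rewrite rmorphM /= -!norm_rnorm normrZ. Qed.

End Scalars.

(** * The Hahn-Banach theorem *)

Section HahnBanach.
Variables (R : realType) (k : scalar_kind) (V : normedModType (scalars R k)).
Local Notation K := (scalars R k).

(** The graph of a partial real-linear functional dominated by the norm; the
    empty graph is allowed, so that every chain has an upper bound. *)
Definition dominated_graph (G : set (V * R)) : Prop :=
  (forall r x a y b, G (x, a) -> G (y, b) ->
     G (of_real k r *: x + y, r * a + b)) /\
  (forall x a, G (x, a) -> a <= rnorm x).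

Lemma dominated_graph_scale G r x a :
  dominated_graph G -> G (x, a) -> G (of_real k r *: x, r * a).
Proof.
move=> [lin _] Gx; have := lin (r - 1) _ _ _ _ Gx Gx.
by rewrite rmorphB rmorph1 scalerBl scale1r subrK mulrBl mul1r subrK.
Qed.

(** The value c at x must lie above all a - |y - x| and below all |y + x| - a for
    (y, a) in G; the triangle inequality leaves room for the supremum of the
    lower bounds. *)
Lemma dominated_graph_extension G x : dominated_graph G -> G !=set0 ->
  exists c, dominated_graph [set (p.1 + of_real k r *: x, p.2 + r * c) |
                             p in G & r in [set: R]].
Proof.
move=> domG [[y0 a0] G0].
have [lin dom] := domG.
have bnd y a y' a' : G (y, a) -> G (y', a') ->
    a - rnorm (y - x) <= rnorm (y' + x) - a'.
  move=> Gy Gy'; have := dom _ _ (lin 1 _ _ _ _ Gy Gy').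
  rewrite rmorph1 scale1r mul1r => le.
  have := rnormD (y - x) (y' + x).
  by rewrite addrACA addNr addr0; lra.
pose S := [set p.2 - rnorm (p.1 - x) | p in G].
have Sub y a : G (y, a) -> ubound S (rnorm (y + x) - a).
  by move=> Gy _ [[y' a'] Gy' <-]; exact: bnd.
have Ssup : has_sup S.
  split; first by exists (a0 - rnorm (y0 - x)); exists (y0, a0).
  by exists (rnorm (y0 + x) - a0); exact: Sub.
have lo y a : G (y, a) -> a - rnorm (y - x) <= sup S.
  by move=> Gy; apply: ub_le_sup; [case: Ssup | exists (y, a)].
have hi y a : G (y, a) -> sup S <= rnorm (y + x) - a.
  by move=> Gy; apply: ge_sup; [case: Ssup | exact: Sub].
exists (sup S); split.
  move=> r _ _ _ _ [[y a] Gy [s _ [<- <-]]] [[y' a'] Gy' [s' _ [<- <-]]] /=.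
  exists (of_real k r *: y + y', r * a + a'); first exact: lin.
  exists (r * s + s') => //=; congr pair.
    by rewrite rmorphD rmorphM scalerDr scalerDl scalerA addrACA.
  by ring.
move=> _ _ [[y a] Gy [r _ [<- <-]]] /=.
have [r0|r0|->] := ltgtP r 0; last by rewrite rmorph0 scale0r mul0r !addr0 dom.
- have Gs := dominated_graph_scale (- r)^-1 domG Gy.
  have := lo _ _ Gs; rewrite -(@ler_pM2l _ (- r)) ?oppr_gt0 // mulrBr mulrA.
  rewrite mulfV ?oppr_eq0 ?lt_eqF // mul1r.
  have -> : - r * rnorm (of_real k (- r)^-1 *: y - x) = rnorm (y + of_real k r *: x).
    rewrite -{1}[- r]gtr0_norm ?oppr_gt0 // -(rnorm_of_real k) -rnormZ.
    rewrite scalerBr scalerA -rmorphM mulfV ?oppr_eq0 ?lt_eqF //.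
    by rewrite rmorph1 scale1r rmorphN scaleNr opprK.
  by lra.
- have Gs := dominated_graph_scale r^-1 domG Gy.
  have := hi _ _ Gs; rewrite -(@ler_pM2l _ r) // mulrBr mulrA.
  rewrite mulfV ?gt_eqF // mul1r.
  have -> : r * rnorm (of_real k r^-1 *: y + x) = rnorm (y + of_real k r *: x).
    rewrite -{1}[r]gtr0_norm // -(rnorm_of_real k) -rnormZ.
    rewrite scalerDr scalerA -rmorphM mulfV ?gt_eqF //.
    by rewrite rmorph1 scale1r.
  by lra.
Qed.

(** Zorn's lemma, starting from the line through x0 on which the functional is the
    norm along x0; over complex scalars the functional is real-linear only. *)
Lemma real_hahn_banach (x0 : V) : exists f : V -> R,
  [/\ forall r x y, f (of_real k r *: x + y) = r * f x + f y,
      forall x, f x <= rnorm x & f x0 = rnorm x0].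
Proof.
pose P := [set G : set (V * R) |
  dominated_graph G /\ (G !=set0 -> G (x0, rnorm x0))].
have [F FP Ftot|A [[domA A0] Amax]] := @Zorn_bigcup _ P.
  split; last by move=> [p [G FG Gp]]; exists G => //; apply: (FP _ FG).2; exists p.
  split=> [r x a y b [G FG Gx] [H FH Hy]|x a [G FG Gx]]; last exact: (FP _ FG).1.2.
  have [sub|sub] := Ftot _ _ FG FH.
    by exists H => //; apply: (FP _ FH).1.1 => //; exact: sub.
  by exists G => //; apply: (FP _ FG).1.1 => //; exact: sub.
have PG0 : P [set (of_real k r *: x0, r * rnorm x0) | r in [set: R]].
  split; last by move=> _; exists 1; rewrite // rmorph1 scale1r mul1r.
  split=> [r _ _ _ _ [s _ [<- <-]] [t _ [<- <-]]|_ _ [s _ [<- <-]]].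
    exists (r * s + t) => //.
    by rewrite scalerA -scalerDl rmorphD rmorphM mulrDl mulrA.
  by rewrite rnormZ rnorm_of_real ler_wpM2r ?rnorm_ge0 ?ler_norm.
have An0 : A !=set0.
  apply/set0P/negP => /eqP A00.
  apply: (Amax _ _ PG0); rewrite A00; split=> // /(_ (of_real k 0 *: x0, 0 * rnorm x0)).
  by apply; exists 0.
have Ax0 := A0 An0.
have A00 : A (0, 0).
  by have := dominated_graph_scale 0 domA Ax0; rewrite rmorph0 scale0r mul0r.
have tot x : exists a, A (x, a).
  have [c domB] := dominated_graph_extension x domA An0.
  apply: contrapT => nx.
  pose B := [set (p.1 + of_real k r *: x, p.2 + r * c) | p in A & r in [set: R]].
  have subAB : A `<=` B.
    move=> [y a] Ay; exists (y, a) => //.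
    by exists 0; rewrite // rmorph0 scale0r mul0r !addr0.
  have PB : P B by split=> // _; exact: subAB.
  apply: (Amax _ _ PB); split=> // sub.
  apply: nx; exists c; apply: sub; exists (0, 0) => //; exists 1 => //=.
  by rewrite rmorph1 scale1r mul1r !add0r.
have [f Af] := choice tot.
have uniq x a b : A (x, a) -> A (x, b) -> a = b.
  move=> Aa Ab; apply/eqP; rewrite eq_le.
  have := domA.2 _ _ (domA.1 (-1) _ _ _ _ Aa Ab).
  have := domA.2 _ _ (domA.1 (-1) _ _ _ _ Ab Aa).
  rewrite rmorphN rmorph1 scaleN1r addNr rnorm0; lra.
exists f; split=> [r x y|x|]; last exact: uniq (Af _) Ax0.
  by apply: uniq (Af _) _; apply: domA.1.
exact: domA.2.
Qed.

End HahnBanach.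

Section ComplexHahnBanach.
Variables (R : realType).

(** Over the complex scalars, F x = f x - i f (i x). *)
Lemma complexify k (V : normedModType (scalars R k)) (f : V -> R) :
  (forall r x y, f (of_real k r *: x + y) = r * f x + f y) ->
  exists F : {linear V -> (scalars R k)^o}, forall x, real_part (F x : scalars R k) = f x.
Proof.
case: k V f => V f flin.
  pose L := GRing.isLinear.Build R V R^o *:%R (f : V -> R^o) flin.
  by exists (HB.pack (f : V -> R^o) L : {linear V -> R^o}).
have f0 : f 0 = 0.
  by have := flin (-1) 0 0; rewrite scaler0 addr0 mulN1r addNr.
have fD x y : f (x + y) = f x + f y.
  by have := flin 1 x y; rewrite rmorph1 scale1r mul1r.
have fZ r x : f (of_real ComplexScalars r *: x) = r * f x.
  by have := flin r x 0; rewrite !addr0 f0 addr0.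
pose I : scalars R ComplexScalars := ('i)%C.
pose F x : (scalars R ComplexScalars)^o := (Complex (f x) (- f (I *: x))).
have lin : linear F.
  move=> [p q] x y.
  have E : (Complex p q : scalars R ComplexScalars) =
      of_real ComplexScalars p + of_real ComplexScalars q * I.
    by apply/eqP; rewrite eq_complex /=; apply/andP; split; apply/eqP => /=; ring.
  have E' : I * (Complex p q : scalars R ComplexScalars) =
      of_real ComplexScalars p * I + of_real ComplexScalars (- q).
    by apply/eqP; rewrite eq_complex /=; apply/andP; split; apply/eqP => /=; ring.
  have -> : F (Complex p q *: x + y) = Complex (p * f x + q * f (I *: x) + f y)
     (- (p * f (I *: x) + (- q) * f x + f (I *: y))).
    rewrite /F scalerDr scalerA E' E !scalerDl -!scalerA !fD !fZ.
    by [].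
  by apply/eqP; rewrite eq_complex /=; apply/andP; split; apply/eqP => /=; ring.
pose L := GRing.isLinear.Build _ V _ *:%R F lin.
by exists (HB.pack F L : {linear V -> (scalars R ComplexScalars)^o}).
Qed.

(** Multiplying x by the conjugate of F x makes the value of F real, which turns
    the bound on the real part into one on the modulus. *)
Theorem hahn_banach k (V : normedModType (scalars R k)) (x0 : V) :
  exists F : {linear V -> (scalars R k)^o},
    (forall x, rnorm (F x) <= rnorm x) /\ rnorm x0 <= rnorm (F x0).
Proof.
have [f [flin fdom fx0]] := real_hahn_banach x0.
have [F Ff] := complexify flin.
exists F; split=> [x|]; last first.
  by rewrite -fx0 -Ff (le_trans (ler_norm _)) ?real_part_le.
have := fdom (conj (F x : scalars R k) *: x).
rewrite -Ff linearZ /= [X in real_part X]mulrC mul_conj of_realK rnormZ rnorm_conj.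
rewrite expr2; have [Fx0 _|Fx0] := leP (rnorm (F x)) 0.
  exact: le_trans Fx0 (rnorm_ge0 _).
by rewrite ler_pM2l.
Qed.

End ComplexHahnBanach.

(** * Hermitian forms and Euclidean norms *)

Lemma cauchy_schwarz (R : realType) (I : finType) (a b : I -> R) :
  (\sum_i a i * b i) ^+ 2 <= (\sum_i a i ^+ 2) * (\sum_i b i ^+ 2).
Proof.
set S := \sum_i _; set N := \sum_i a i ^+ 2; set M := \sum_i b i ^+ 2.
have M0 : 0 <= M by apply: sumr_ge0 => i _; exact: sqr_ge0.
have : 0 <= \sum_i (M * a i - S * b i) ^+ 2.
  by apply: sumr_ge0 => i _; exact: sqr_ge0.
have -> : \sum_i (M * a i - S * b i) ^+ 2 = M * (N * M - S ^+ 2).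
  transitivity (\sum_i (M ^+ 2 * a i ^+ 2 + (- 2 * M * S) * (a i * b i) +
                        S ^+ 2 * b i ^+ 2)).
    by apply: eq_bigr => i _; ring.
  by rewrite !big_split -!mulr_sumr /= -/S -/N -/M; ring.
have [M1|M1 _] := ltP 0 M; first by rewrite pmulr_rge0 // subr_ge0.
have /(psumr_eq0P (fun i _ => sqr_ge0 (b i))) b0 : M = 0 by apply/le_anti/andP.
rewrite /S big1 ?expr0n ?mulr_ge0 //; first by apply: sumr_ge0 => i _; exact: sqr_ge0.
move=> i _; have /eqP := b0 i isT.
by rewrite sqrf_eq0 => /eqP ->; rewrite mulr0.
Qed.

Section Adjoint.
Variables (R : realType) (k : scalar_kind).
Local Notation K := (scalars R k).

Definition adj m n (A : 'M[K]_(m, n)) : 'M[K]_(n, m) := (map_mx (@conj R k) A)^T.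

Lemma adjM m n p (A : 'M[K]_(m, n)) (B : 'M[K]_(n, p)) :
  adj (A *m B) = adj B *m adj A.
Proof. by rewrite /adj map_mxM trmx_mul. Qed.

Lemma adjK m n (A : 'M[K]_(m, n)) : adj (adj A) = A.
Proof. by apply/matrixP => i j; rewrite !mxE conjK. Qed.

Lemma adj1 n : adj (1%:M : 'M[K]_n) = 1%:M.
Proof. by rewrite /adj map_mx1 trmx1. Qed.

Lemma adjB m n (A B : 'M[K]_(m, n)) : adj (A - B) = adj A - adj B.
Proof. by rewrite /adj map_mxB linearB. Qed.

Lemma l2norm_ge0 n (v : 'rV[K]_n) : 0 <= l2norm v.
Proof. exact: sqrtr_ge0. Qed.

Lemma l2norm_sqr n (v : 'rV[K]_n) :
  l2norm v ^+ 2 = \sum_i rnorm (v 0 i : K) ^+ 2.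
Proof. by rewrite sqr_sqrtr //; apply: sumr_ge0 => i _; exact: sqr_ge0. Qed.

Lemma mul_adj_l2norm n (v : 'rV[K]_n) :
  (v *m adj v) 0 0 = of_real k (l2norm v ^+ 2).
Proof.
rewrite mxE l2norm_sqr rmorph_sum; apply: eq_bigr => i _.
by rewrite !mxE mul_conj.
Qed.

Lemma l2norm_sqrE n (v : 'rV[K]_n) :
  l2norm v ^+ 2 = real_part ((v *m adj v) 0 0).
Proof. by rewrite mul_adj_l2norm of_realK. Qed.

Lemma l2norm_le n m (v : 'rV[K]_n) (w : 'rV[K]_m) :
  (l2norm v <= l2norm w) = (l2norm v ^+ 2 <= l2norm w ^+ 2).
Proof. by rewrite ler_sqr ?nnegrE ?l2norm_ge0. Qed.

Lemma l2norm0 n : l2norm (0 : 'rV[K]_n) = 0.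
Proof.
by rewrite /l2norm big1 ?sqrtr0 // => i _; rewrite mxE rnorm0 expr0n.
Qed.

Lemma l2norm_eq0 n (v : 'rV[K]_n) : l2norm v = 0 -> v = 0.
Proof.
move=> v0; apply/rowP => i; rewrite mxE; apply: rnorm_eq0.
have /(psumr_eq0P (fun j _ => sqr_ge0 _)) h : \sum_j rnorm (v 0 j : K) ^+ 2 = 0.
  by rewrite -l2norm_sqr v0 expr0n.
by have /eqP := h i isT; rewrite sqrf_eq0 => /eqP.
Qed.

Lemma l2normZ n a (v : 'rV[K]_n) : l2norm (a *: v) = rnorm (a : K) * l2norm v.
Proof.
apply/eqP; rewrite -(@eqrXn2 _ 2) ?l2norm_ge0 ?mulr_ge0 ?rnorm_ge0 ?l2norm_ge0 //.
rewrite exprMn !l2norm_sqr mulr_sumr; apply/eqP/eq_bigr => i _.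
by rewrite !mxE rnormM exprMn.
Qed.

Lemma rnorm_le_l2norm n (v : 'rV[K]_n) i : rnorm (v 0 i : K) <= l2norm v.
Proof.
rewrite -(@ler_sqr R) ?nnegrE ?l2norm_ge0 ?rnorm_ge0 // l2norm_sqr (bigD1 i) //=.
by rewrite lerDl sumr_ge0 // => j _; exact: sqr_ge0.
Qed.

Lemma l2_cauchy_schwarz n (v w : 'rV[K]_n) :
  \sum_i rnorm (v 0 i : K) * rnorm (w 0 i : K) <= l2norm v * l2norm w.
Proof.
rewrite -ler_sqr ?nnegrE ?mulr_ge0 ?l2norm_ge0 //; last first.
  by apply: sumr_ge0 => j _; rewrite mulr_ge0 ?rnorm_ge0.
by rewrite exprMn !l2norm_sqr cauchy_schwarz.
Qed.

Lemma l2norm_isometry m n (J : 'M[K]_(m, n)) (c : 'rV[K]_m) :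
  J *m adj J = 1%:M -> l2norm (c *m J) = l2norm c.
Proof.
move=> J1; apply/eqP; rewrite -(@eqrXn2 _ 2) ?l2norm_ge0 // !l2norm_sqrE.
by rewrite adjM mulmxA -(mulmxA c) J1 mulmx1.
Qed.

(** Bessel's inequality: x minus its projection x J* J has nonnegative square
    norm. *)
Lemma l2norm_coisometry m n (J : 'M[K]_(m, n)) (x : 'rV[K]_n) :
  J *m adj J = 1%:M -> l2norm (x *m adj J) <= l2norm x.
Proof.
move=> J1; rewrite l2norm_le -subr_ge0.
suff -> : l2norm x ^+ 2 - l2norm (x *m adj J) ^+ 2 =
          l2norm (x - x *m adj J *m J) ^+ 2 by exact: sqr_ge0.
rewrite !l2norm_sqrE -raddfB; congr (real_part _).
rewrite adjB !adjM adjK mulmxBr !mulmxBl !mulmxA.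
rewrite -(mulmxA _ J (adj J)) J1 mulmx1 subrr subr0.
by rewrite !mxE.
Qed.

(** Polarisation: on the vectors e_i + Q_ij e_j the form recovers the square
    modulus of the entry Q_ij. *)
Lemma hermitian_anisotropic n (Q : 'M[K]_n) :
  adj Q = Q -> Q != 0 -> exists v : 'rV[K]_n, (v *m Q *m adj v) 0 0 != 0.
Proof.
move=> QQ; apply: contra_neqP => /forallNP nv.
have {}nv (v : 'rV[K]_n) : (v *m Q *m adj v) 0 0 = 0 by apply: contrapT => /eqP; exact: nv.
have E i j : ((delta_mx 0 i : 'rV[K]_n) *m Q *m adj (delta_mx 0 j : 'rV[K]_n)) 0 0 = Q i j.
  rewrite -rowE mxE (bigD1 j) //= big1 => [|l lj]; rewrite !mxE !eqxx /=.
    by rewrite rmorph1 mulr1 addr0.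
  by rewrite (negPf lj) rmorph0 mulr0.
have adjDZ (u w : 'rV[K]_n) a : adj (u + a *: w) = adj u + conj a *: adj w.
  by apply/matrixP => x y; rewrite !mxE rmorphD rmorphM.
apply/matrixP => i j; rewrite [RHS]mxE.
have := nv (delta_mx 0 i + Q i j *: delta_mx 0 j : 'rV[K]_n).
rewrite adjDZ mulmxDr !mulmxDl -!scalemxAr -!scalemxAl.
have mxDE (A B : 'M[K]_1) : (A + B) 0 0 = A 0 0 + B 0 0 by rewrite mxE.
have mxZE a (A : 'M[K]_1) : (a *: A) 0 0 = a * A 0 0 by rewrite mxE.
rewrite !(mxDE, mxZE).
have Qd l : Q l l = 0 by rewrite -E nv.
have Qji : Q j i = conj (Q i j) by rewrite -[in LHS]QQ !mxE.
rewrite !E !Qd Qji !(mulr0, addr0, add0r) [conj _ * _]mulrC mul_conj.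
rewrite -rmorphD => /(congr1 (@real_part R k)); rewrite of_realK raddf0 => Q0.
apply: (@rnorm_eq0 R k K); have := sqr_ge0 (rnorm (Q i j : K)) => h.
have /eqP : rnorm (Q i j : K) ^+ 2 = 0 by lra.
by rewrite sqrf_eq0 => /eqP.
Qed.

Lemma row_free_eq0 m n (A : 'M[K]_(m, n)) (c : 'rV[K]_m) :
  row_free A -> c *m A = 0 -> c = 0.
Proof. by move=> Af cA; apply: (row_free_inj Af); rewrite cA mul0mx. Qed.

Lemma row_free_mulmx m n p (A : 'M[K]_(m, n)) (B : 'M[K]_(n, p)) :
  row_free A -> row_free B -> row_free (A *m B).
Proof.
move=> Af Bf; apply: inj_row_free => c; rewrite mulmxA.
by move=> /(row_free_eq0 Bf); exact: row_free_eq0.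
Qed.

(** Split off a vector v on which the form does not vanish; its orthogonal
    complement is the kernel of u = Q v*, of dimension one less. *)
Theorem hermitian_diagonalization n (Q : 'M[K]_n) :
  adj Q = Q -> exists2 G, G \in unitmx & is_diag_mx (G *m Q *m adj G).
Proof.
elim: n Q => [|n IHn] Q QQ; first by exists 1%:M; [exact: unitmx1|apply/is_diag_mxP; case].
have [->|/(hermitian_anisotropic QQ)[v v0]] := eqVneq Q 0.
  by exists 1%:M; rewrite ?unitmx1 // mulmx0 mul0mx mx0_is_diag.
pose u := Q *m adj v.
have vu : (v *m u) 0 0 != 0 by rewrite /u mulmxA.
have rk : \rank (kermx u) = n.
  rewrite mxrank_ker; have : (\rank u <= 1)%N by exact: rank_leq_col.
  case: (\rank u) (mxrank_eq0 u) => [|[|//]] /=; last by rewrite subn1.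
  by move/esym/eqP => u0; rewrite u0 mulmx0 mxE eqxx in vu.
have [B [Bf Bu]] : exists B : 'M[K]_(n, n.+1), row_free B /\ B *m u = 0.
  have : exists B : 'M[K]_(\rank (kermx u), n.+1), row_free B /\ B *m u = 0.
    exists (row_base (kermx u)); split; first exact: row_base_free.
    by apply/sub_kermxP; rewrite eq_row_base.
  by rewrite rk.
pose G0 : 'M[K]_(1 + n, n.+1) := col_mx v B.
have G0u : (G0 : 'M[K]_n.+1) \in unitmx.
  rewrite -row_free_unit; apply: inj_row_free.
  suff G0f (c : 'rV[K]_(1 + n)) : c *m G0 = 0 -> c = 0 by exact: G0f.
  rewrite -[c]hsubmxK mul_row_col => e.
  have l0 : lsubmx c = 0.
    have /matrixP /(_ 0 0) := congr1 (mulmx^~ u) e.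
    rewrite mulmxDl -!mulmxA Bu mulmx0 addr0 mul0mx mxE big_ord1 [RHS]mxE.
    move/eqP; rewrite mulf_eq0 (negPf vu) orbF => /eqP l00.
    by apply/matrixP => i j; rewrite !ord1 l00 mxE.
  move: e; rewrite l0 mul0mx add0r => /(row_free_eq0 Bf) ->.
  by rewrite row_mx0.
have Qv : v *m Q *m adj B = 0.
  have -> : v *m Q *m adj B = adj (B *m u) by rewrite /u !adjM adjK QQ.
  by rewrite Bu /adj map_mx0 trmx0.
have /IHn[G' G'u Gd] : adj (B *m Q *m adj B) = B *m Q *m adj B.
  by rewrite !adjM adjK QQ mulmxA.
pose G1 : 'M[K]_(1 + n) := block_mx 1%:M 0 0 G'.
have G1u : G1 \in unitmx by rewrite unitmxE det_ublock det1 mul1r -unitmxE.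
exists (G1 *m G0 : 'M[K]_n.+1).
  by rewrite unitmx_mul G0u andbT.
have adjG1 : adj G1 = block_mx 1%:M 0 0 (adj G').
  by rewrite /adj map_block_mx tr_block_mx !map_mx0 !trmx0 map_mx1 trmx1.
have adjG0 : adj G0 = row_mx (adj v) (adj B).
  by rewrite /adj map_col_mx tr_col_mx.
pose D : 'M[K]_(1 + n) := block_mx (v *m Q *m adj v) 0 0 (B *m Q *m adj B).
have G0QG0 : G0 *m Q *m adj G0 = D.
  by rewrite adjG0 /G0 mul_col_mx mul_col_row Qv -(mulmxA B Q (adj v)) -/u Bu.
have G1DG1 : G1 *m D *m adj G1 =
    block_mx (v *m Q *m adj v) 0 0 (G' *m (B *m Q *m adj B) *m adj G').
  by rewrite adjG1 !mulmx_block !(mul0mx, mulmx0, mul1mx, mulmx1, add0r, addr0).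
have G1d : is_diag_mx (G1 *m D *m adj G1).
  by rewrite G1DG1 is_diag_block_mx // !eqxx Gd mx11_is_diag.
suff -> : (G1 *m G0 : 'M[K]_n.+1) *m Q *m adj (G1 *m G0 : 'M[K]_n.+1) =
    G1 *m D *m adj G1 by [].
by rewrite -G0QG0 adjM !mulmxA.
Qed.

(** Rescaling the diagonalising basis of the positive definite form B B*. *)
Lemma orthonormalization h n (B : 'M[K]_(h, n)) : row_free B ->
  exists2 G, G \in unitmx & (G *m B) *m adj (G *m B) = 1%:M.
Proof.
move=> Bf.
have [|G Gu /is_diag_mxP Gd] := @hermitian_diagonalization _ (B *m adj B).
  by rewrite adjM adjK.
pose C := G *m B.
have CCE : G *m (B *m adj B) *m adj G = C *m adj C by rewrite /C adjM !mulmxA.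
pose d i := l2norm (row i C).
have dE (M : 'M[K]_(h, n)) i j : (M *m adj M) i j = (row i M *m adj (row j M)) 0 0.
  by rewrite !mxE; apply: eq_bigr => l _; rewrite !mxE.
have d0 i : d i != 0.
  apply/eqP => /l2norm_eq0 ri.
  have Cf : row_free C by apply: row_free_mulmx; rewrite ?row_free_unit.
  have : delta_mx 0 i = 0 :> 'rV[K]_h.
    by apply: (row_free_eq0 Cf); rewrite -rowE.
  move=> /matrixP /(_ 0 i); rewrite !mxE !eqxx /= => /eqP.
  by rewrite oner_eq0.
pose E : 'M[K]_h := diag_mx (\row_i of_real k (d i)^-1).
exists (E *m G).
  rewrite unitmx_mul Gu andbT unitmxE det_diag unitfE prodf_seq_neq0.
  apply/allP => i _ /=; rewrite !mxE.
  by rewrite -(rmorph0 (of_real k)) (inj_eq (@of_real_inj R k)) invr_eq0 d0.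
rewrite -(mulmxA E) -/C; apply/matrixP => i j; rewrite dE.
have rE l : row l (E *m C) = of_real k (d l)^-1 *: row l C.
  by apply/rowP => x; rewrite mul_diag_mx !mxE.
rewrite !rE [RHS]mxE; have [->|ij] := eqVneq i j.
  rewrite mul_adj_l2norm l2normZ rnorm_of_real -/(d j).
  rewrite gtr0_norm ?invr_gt0 ?lt_neqAle ?l2norm_ge0 1?eq_sym ?d0 //.
  by rewrite mulVf ?d0 // expr1n rmorph1.
have := Gd i j ij; rewrite CCE dE => ij0.
have -> : adj (of_real k (d j)^-1 *: row j C) = of_real k (d j)^-1 *: adj (row j C).
  by apply/matrixP => x y; rewrite !mxE rmorphM /= conj_of_real.
by rewrite -scalemxAl -scalemxAr [LHS]mxE [X in _ * X]mxE ij0 !mulr0.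
Qed.

Definition herm_form n (Q : 'M[K]_n) (v : 'rV[K]_n) : R :=
  real_part ((v *m Q *m adj v) 0 0).

(** In a diagonalising basis, keep the vectors on which the form has the more
    frequent sign. *)
Lemma semidefinite_half n (Q : 'M[K]_n) : adj Q = Q ->
  exists h (H : 'M[K]_(h, n)), [/\ row_free H, (n <= 2 * h)%N &
    (forall c, 0 <= herm_form Q (c *m H)) \/ (forall c, herm_form Q (c *m H) <= 0)].
Proof.
move=> QQ; have [G Gu /is_diag_mxP Gd] := hermitian_diagonalization QQ.
have [D DE] : {D | D = G *m Q *m adj G} by exists (G *m Q *m adj G).
rewrite -DE in Gd.
have formE (S : {pred 'I_n}) (c : 'rV[K]_(#|S|)) :
    herm_form Q (c *m rowsub (enum_val (A := S)) G) =
    \sum_i rnorm (c 0 i : K) ^+ 2 * real_part (D (enum_val i) (enum_val i)).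
  rewrite /herm_form adjM -!mulmxA (mulmxA _ Q) (mulmxA _ _ (adj c)).
  have -> : rowsub (enum_val (A := S)) G *m Q *m adj (rowsub (enum_val (A := S)) G) =
      mxsub (enum_val (A := S)) (enum_val (A := S)) D.
    by apply/matrixP => i j; rewrite DE !mxE; apply: eq_bigr => l _;
       rewrite !mxE; congr (_ * _); apply: eq_bigr => l' _; rewrite !mxE.
  rewrite mxE raddf_sum; apply: eq_bigr => i _ /=.
  rewrite !mxE (bigD1 i) //= big1 ?addr0 => [|j ji].
    by rewrite !mxE mulrCA mul_conj mulrC real_partZ.
  rewrite !mxE (Gd (enum_val i) (enum_val j)) ?mul0r //.
  by rewrite (inj_eq (@ord_inj _)) (inj_eq enum_val_inj) eq_sym.
have free (S : {pred 'I_n}) : row_free (rowsub (enum_val (A := S)) G).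
  rewrite rowsubE; apply: row_free_mulmx; last by rewrite row_free_unit.
  apply: inj_row_free => c /rowP c0; apply/rowP => i.
  have := c0 (enum_val i); rewrite !mxE (bigD1 i) //= big1 => [|j ji].
    by rewrite !mxE eqxx mulr1 addr0.
  by rewrite !mxE (inj_eq enum_val_inj) (negPf ji) mulr0.
pose P : {pred 'I_n} := [pred i | 0 <= real_part (D i i)].
have : (n <= 2 * #|P|)%N \/ (n <= 2 * #|[predC P]|)%N.
  have := cardC P; rewrite card_ord; move: #|P| #|[predC P]| => a b; lia.
case=> le.
  exists #|P|, (rowsub (enum_val (A := P)) G); split; [exact: free|exact: le|left=> c].
  rewrite formE; apply: sumr_ge0 => i _; rewrite mulr_ge0 ?sqr_ge0 //.
  exact: (enum_valP i).
exists #|[predC P]|, (rowsub (enum_val (A := [predC P])) G); split; [exact: free|exact: le|right=> c].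
rewrite formE -oppr_ge0 -sumrN; apply: sumr_ge0 => i _.
rewrite -mulrN mulr_ge0 ?sqr_ge0 //.
by rewrite oppr_ge0 ltW // ltNge; exact: (enum_valP i).
Qed.

(** Two Euclidean norms on the same space, |c| and |c A|: on a subspace of at
    least half the dimension one of them dominates the other, and an orthonormal
    basis for the dominating one is J. *)
Lemma dominating_half r m (A : 'M[K]_(r, m)) : row_free A ->
  exists h (J : 'M[K]_(h, r)), (r <= 2 * h)%N /\
    ((J *m adj J = 1%:M /\ forall c, l2norm (c *m J *m A) <= l2norm c) \/
     ((J *m A) *m adj (J *m A) = 1%:M /\ forall c, l2norm (c *m J) <= l2norm c)).
Proof.
move=> Af; have [|h [H [Hf rh sign]]] := @semidefinite_half _ (1%:M - A *m adj A).
  by rewrite adjB adj1 adjM adjK.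
have formE c : herm_form (1%:M - A *m adj A) c = l2norm c ^+ 2 - l2norm (c *m A) ^+ 2.
  rewrite /herm_form mulmxBr mulmx1 mulmxBl !l2norm_sqrE -raddfB adjM !mulmxA.
  by congr (real_part _); rewrite !mxE.
exists h; case: sign => sign.
  have [G Gu GH] := orthonormalization Hf.
  exists (G *m H); split=> //; left; split=> // c.
  have := sign (c *m G); rewrite formE subr_ge0 -l2norm_le -(mulmxA c).
  by rewrite (l2norm_isometry _ GH).
have [G Gu GH] := orthonormalization (row_free_mulmx Hf Af).
exists (G *m H); split=> //; right; rewrite -(mulmxA G); split=> // c.
have := sign (c *m G); rewrite formE subr_le0 -l2norm_le -!(mulmxA c) -(mulmxA G).
by rewrite (l2norm_isometry _ GH).
Qed.

End Adjoint.

(** * Weak Hilbert spaces and factorizations of the identity *)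

Section Factorization.
Variables (R : realType) (k : scalar_kind).
Local Notation K := (scalars R k).

Section LinearCombination.
Variables (V : lmodType K) (n : nat) (e : 'I_n -> V).

Definition lincomb (c : 'rV[K]_n) : V := \sum_i c 0 i *: e i.

Fact lincomb_linear : linear lincomb.
Proof.
move=> a c d; rewrite /lincomb scaler_sumr -big_split; apply: eq_bigr => i _ /=.
by rewrite !mxE scalerDl scalerA.
Qed.

HB.instance Definition _ :=
  GRing.isLinear.Build K 'rV[K]_n V *:%R lincomb lincomb_linear.

End LinearCombination.

Lemma lincombE (V : lmodType K) n (u : {linear 'rV[K]_n -> V}) c :
  u c = lincomb (fun i => u (delta_mx 0 i)) c.
Proof.
by rewrite [c in LHS]row_sum_delta linear_sum; apply: eq_bigr => i _; rewrite linearZ.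
Qed.

(** An l2^m inside E, the span of u, that is complemented in W: the identity of
    l2^m factors through W with the first factor taking values in E. *)
Definition factors_identity (W : normedModType K) (C : R) n
    (u : {linear 'rV[K]_n -> W}) m : Prop :=
  exists (A : 'M[K]_(m, n)) (p : {linear W -> 'rV[K]_m}),
    [/\ forall c, p (u (c *m A)) = c,
        forall c, rnorm (u (c *m A)) <= C * l2norm c &
        forall w, l2norm (p w) <= C * rnorm w].

(** The quantitative form of the weak Hilbert property used throughout: subspaces
    are given by injective linear maps from coordinate spaces, and a single
    factorization carries both the Banach-Mazur bound and the projection. *)
Definition hilbert_factorization (W : normedModType K) : Prop :=
  exists delta C : R, [/\ 0 < delta, 0 <= C &
    forall n (u : {linear 'rV[K]_n -> W}), injective u ->
      exists2 m : nat, delta * n%:R <= m%:R & factors_identity C u m].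

(** The homogeneity hypotheses are local to x, so that the bound also applies to
    maps that are linear on a subspace only. *)
Lemma opnorm_bound (V W : lmodType K) (A : set V) (N : V -> R) (M : W -> R)
    (T : V -> W) (C : R) x :
    (opnorm A N M T <= C%:E)%E ->
    (forall r, A (of_real k r *: x)) ->
    (forall r, N (of_real k r *: x) = `|r| * N x) ->
    (forall r, M (T (of_real k r *: x)) = `|r| * M (T x)) ->
    0 <= N x -> (N x = 0 -> M (T x) = 0) ->
  M (T x) <= C * N x.
Proof.
move=> TC Ax Nx Mx N0 NM; have [Nx0|Nx0] := eqVneq (N x) 0.
  by rewrite NM // Nx0 mulr0.
have Npos : 0 < N x by rewrite lt_neqAle eq_sym Nx0.
have : (M (T (of_real k (N x)^-1 *: x)) <= C)%R.
  rewrite -lee_fin; apply: le_trans TC; apply: ereal_sup_ubound.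
  exists (of_real k (N x)^-1 *: x) => //; split=> //=.
  by rewrite Nx gtr0_norm ?invr_gt0 // mulVf.
by rewrite Mx gtr0_norm ?invr_gt0 // mulrC ler_pdivrMr.
Qed.

Lemma opnorm_le (V W : Type) (A : set V) (N : V -> R) (M : W -> R)
    (T : V -> W) (C : R) : 0 <= C ->
  (forall x, A x -> M (T x) <= C * N x) -> (opnorm A N M T <= C%:E)%E.
Proof.
move=> C0 TC; apply: ge_ereal_sup => _ [x [Ax Nx] <-]; rewrite lee_fin.
by rewrite (le_trans (TC x Ax)) // ler_piMr.
Qed.

Lemma opnorm_ge0 (V W : Type) (A : set V) (N : V -> R) (M : W -> R)
    (T : V -> W) x : A x -> N x = 0 -> 0 <= M (T x) -> (0 <= opnorm A N M T)%E.
Proof.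
move=> Ax Nx Mx; apply: (@le_trans _ _ (M (T x))%:E); first by rewrite lee_fin.
by apply: ereal_sup_ubound; exists x => //; split=> //=; rewrite Nx.
Qed.

Lemma rnormZr (W : normedModType K) r (w : W) :
  rnorm (of_real k r *: w) = `|r| * rnorm w.
Proof. by rewrite rnormZ rnorm_of_real. Qed.

Lemma l2normZr n r (c : 'rV[K]_n) : l2norm (of_real k r *: c) = `|r| * l2norm c.
Proof. by rewrite l2normZ rnorm_of_real. Qed.

Lemma opnorm_linear_bound (V W : normedModType K) (T : {linear V -> W}) (C : R) x :
  (opnorm [set: V] (@rnorm R k V) (@rnorm R k W) T <= C%:E)%E ->
  rnorm (T x) <= C * rnorm x.
Proof.
move=> TC; apply: (opnorm_bound TC) => // [r|r||].
- exact: rnormZr.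
- by rewrite linearZ rnormZr.
- exact: rnorm_ge0.
- by move/rnorm_eq0 ->; rewrite linear0 rnorm0.
Qed.

Lemma linear_on_scale (V W : lmodType K) (A : set V) (T : V -> W) a x :
  linear_on A T -> A 0 -> A x -> T (a *: x) = a *: T x.
Proof.
move=> Tl A0 Ax; have T0 : T 0 = 0.
  by have := Tl (-1) 0 0 A0 A0; rewrite scaler0 addr0 scaleN1r addNr.
by have := Tl a x 0 Ax A0; rewrite !addr0 T0 addr0.
Qed.

Lemma has_dim_scale (V : lmodType K) (E : set V) n a x : has_dim E n -> E x -> E (a *: x).
Proof.
move=> [e [_ ->]] [c _ <-]; exists (fun i => a * c i) => //.
by rewrite scaler_sumr; apply: eq_bigr => i _; rewrite scalerA.
Qed.

Lemma has_dim0 (V : lmodType K) (E : set V) n : has_dim E n -> E 0.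
Proof.
move=> [e [_ ->]]; exists (fun=> 0) => //.
by rewrite big1 // => i _; rewrite scale0r.
Qed.

Lemma has_dim_range (V : lmodType K) n (u : {linear 'rV[K]_n -> V}) :
  injective u -> has_dim (range u) n.
Proof.
move=> ui; exists (fun i => u (delta_mx 0 i)); split=> [c c0 i|].
  have : u (\row_i c i) = 0.
    by rewrite lincombE -[RHS]c0; apply: eq_bigr => j _; rewrite mxE.
  by rewrite -[RHS](linear0 u) => /ui/rowP/(_ i); rewrite !mxE.
apply/seteqP; split=> [_ [c _ <-]|_ [c _ <-]].
  by exists (fun i => c 0 i) => //; rewrite [RHS]lincombE.
by exists (\row_i c i) => //; rewrite lincombE; apply: eq_bigr => i _; rewrite mxE.
Qed.

Lemma has_dimP (V : lmodType K) (E : set V) n : has_dim E n ->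
  exists2 u : {linear 'rV[K]_n -> V}, injective u & E = range u.
Proof.
move=> [e [ei ->]]; exists (lincomb e).
  move=> c d cd; apply/eqP; rewrite -subr_eq0; apply/eqP/rowP => i.
  rewrite [RHS]mxE; apply: (ei (fun i => (c - d) 0 i)).
  by rewrite -[LHS]/(lincomb e (c - d)) linearB /= cd subrr.
apply/seteqP; split=> [_ [c _ <-]|_ [c _ <-]]; last by exists (fun i => c 0 i).
by exists (\row_i c i) => //; apply: eq_bigr => i _; rewrite mxE.
Qed.

Lemma linear_lift (V : lmodType K) m n (u : {linear 'rV[K]_n -> V})
    (v : {linear 'rV[K]_m -> V}) :
  range v `<=` range u -> exists A : 'M[K]_(m, n), forall c, u (c *m A) = v c.
Proof.
move=> sub; have lift c : exists d, u d = v c.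
  by have [|d _ <-] := sub (v c); [exists c|exists d].
have [g ug] := choice lift.
exists (\matrix_i g (delta_mx 0 i)) => c.
rewrite mulmx_sum_row linear_sum [RHS]lincombE; apply: eq_bigr => i _.
by rewrite linearZ /= rowK ug.
Qed.

Lemma factors_identity0 (W : normedModType K) C n (u : {linear 'rV[K]_n -> W}) :
  0 <= C -> factors_identity C u 0.
Proof.
move=> C0; exists 0, \0; split=> [c|c|w]; first by rewrite [c]thinmx0.
  by rewrite mulmx0 linear0 rnorm0 mulr_ge0 ?l2norm_ge0.
by rewrite [X in l2norm X]thinmx0 l2norm0 mulr_ge0 ?rnorm_ge0.
Qed.

(** The isomorphism T : F -> l2^m and its inverse S are only controlled through the
    product of their norms, so T composed with the projection and S are rescaled
    by the norm b of T. *)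
Lemma hilbert_factorization_intro (W : normedModType K) :
  weak_hilbert W -> hilbert_factorization W.
Proof.
move=> [delta [C [delta0 _ C1 wh]]].
have C0 : 0 <= C by lra.
exists delta, (C + 1); split=> [//||n u ui]; first by lra.
have [F [m [dimF FE dm bm [P [PF PFid PC]]]]] := wh _ n (has_dim_range ui).
exists m => //; case: m => [|m] in dimF dm bm *.
  by apply: factors_identity0; lra.
have : (banach_mazur F (@rnorm R k W) [set: 'rV[K]_m.+1] (@l2norm R k m.+1) < (C + 1)%:E)%E.
  by apply: (le_lt_trans bm); rewrite lte_fin; lra.
move=> /ereal_inf_lt[_ [T [S [[Tl Sl] [TF SF] [STK TSK] ->]]]] TSC.
have F0 := has_dim0 dimF.
have TZ a x : F x -> T (a *: x) = a *: T x by exact: linear_on_scale.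
have SZ a c : S (a *: c) = a *: S c by exact: (linear_on_scale _ Sl).
have SF' c : F (S c) by exact: SF.
have TSK' c : T (S c) = c by exact: TSK.
set t := opnorm F _ _ T in TSC; set s := opnorm _ _ _ S in TSC.
(* Both norms are positive in positive dimension, so a finite product has finite factors. *)
have e0 : (delta_mx 0 0 : 'rV[K]_m.+1) != 0.
  by apply/eqP => /matrixP /(_ 0 0) /eqP; rewrite !mxE eqxx oner_eq0.
have s0 : (0 < s)%E.
  rewrite ltNge; apply/negP => s0; case/negP: e0; apply/eqP.
  suff : rnorm (S (delta_mx 0 0)) <= 0 * l2norm (delta_mx 0 0 : 'rV[K]_m.+1).
    rewrite mul0r => h; have /rnorm_eq0 S0 : rnorm (S (delta_mx 0 0)) = 0.
      by apply/le_anti; rewrite h rnorm_ge0.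
    by rewrite -[LHS]TSK' S0 -[X in T X](scale0r (0 : W)) TZ // scale0r.
  apply: (opnorm_bound s0) => // [r|r||/l2norm_eq0 ->].
  - exact: l2normZr.
  - by rewrite SZ rnormZr.
  - exact: l2norm_ge0.
  - by rewrite -(scale0r (0 : 'rV_m.+1)) SZ scale0r rnorm0.
have TN r x : F x -> l2norm (T (of_real k r *: x)) = `|r| * l2norm (T x).
  by move=> Fx; rewrite TZ // l2normZr.
have T0 : T 0 = 0 by rewrite -[X in T X](scale0r (0 : W)) TZ // scale0r.
have Tbound b x : (t <= b%:E)%E -> F x -> l2norm (T x) <= b * rnorm x.
  move=> tb Fx; apply: (opnorm_bound tb) => [r|r|r||/rnorm_eq0 ->].
  - exact: has_dim_scale dimF Fx.
  - exact: rnormZr.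
  - exact: TN.
  - exact: rnorm_ge0.
  - by rewrite T0 l2norm0.
have t0 : (0 < t)%E.
  rewrite ltNge; apply/negP => t0; case/negP: e0; apply/eqP; apply: l2norm_eq0.
  apply/le_anti; rewrite l2norm_ge0 andbT -[X in l2norm X]TSK'.
  by have := Tbound 0 _ t0 (SF' (delta_mx 0 0)); rewrite mul0r.
have Sbound a c : (s <= a%:E)%E -> rnorm (S c) <= a * l2norm c.
  move=> sa; apply: (opnorm_bound sa) => // [r|r||/l2norm_eq0 ->].
  - exact: l2normZr.
  - by rewrite SZ rnormZr.
  - exact: l2norm_ge0.
  - by rewrite -(scale0r (0 : 'rV_m.+1)) SZ scale0r rnorm0.
have [a sE] : exists a, s = a%:E.
  case: s s0 TSC {Sbound} => [a|//|//] s0; first by exists a.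
  by rewrite gt0_muley.
have [b tE] : exists b, t = b%:E.
  case: t t0 TSC {Tbound} => [b|//|//] t0; first by exists b.
  by rewrite gt0_mulye.
rewrite sE lte_fin in s0; rewrite tE lte_fin in t0.
rewrite sE tE -EFinM lte_fin in TSC.
have vlin : linear (fun c => of_real k b *: S c).
  move=> x c d; rewrite Sl // scalerDr; congr (_ + _).
  by rewrite !scalerA mulrC.
pose v : {linear 'rV[K]_m.+1 -> W} :=
  HB.pack (fun c => of_real k b *: S c) (GRing.isLinear.Build _ _ _ _ _ vlin).
have plin : linear (fun w => of_real k b^-1 *: T (P w)).
  move=> x c d; rewrite linearP Tl // scalerDr; congr (_ + _).
  by rewrite !scalerA mulrC.
pose p : {linear W -> 'rV[K]_m.+1} :=
  HB.pack (fun w => of_real k b^-1 *: T (P w)) (GRing.isLinear.Build _ _ _ _ _ plin).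
have Fv c : F (v c) by exact: has_dim_scale dimF (SF' c).
have [A uA] : exists A : 'M[K]_(m.+1, n), forall c, u (c *m A) = v c.
  by apply: linear_lift => _ [c _ <-]; exact/FE/Fv.
exists A, p; split=> [c|c|w].
- rewrite uA /= PFid; last exact: (Fv c).
  by rewrite TZ // scalerA -rmorphM mulVf ?gt_eqF // rmorph1 scale1r TSK'.
- rewrite uA /= rnormZr gtr0_norm //.
  have := Sbound a c; rewrite sE lexx => /(_ isT) h.
  rewrite (le_trans (ler_wpM2l (ltW t0) h)) // mulrA ler_wpM2r ?l2norm_ge0 //.
  exact: ltW.
- rewrite /= l2normZr gtr0_norm ?invr_gt0 //.
  have := Tbound b _ _ (PF w); rewrite tE lexx => /(_ isT) h.
  rewrite ler_pdivrMl // (le_trans h) // ler_pM2l //.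
  by rewrite (le_trans (opnorm_linear_bound w PC)) // ler_wpM2r ?rnorm_ge0 //; lra.
Qed.

Lemma hilbert_factorization_elim (W : normedModType K) :
  hilbert_factorization W -> weak_hilbert W.
Proof.
move=> [delta [C [delta0 C0 wh]]].
exists (Num.min delta 1), (Num.max (C * C) 1); split.
- by rewrite lt_min delta0 ltr01.
- by rewrite ge_min lexx orbT.
- by rewrite le_max lexx orbT.
move=> E n /has_dimP[u ui ->].
have [m dm [A [p [pK vC pC]]]] := wh n u ui.
have vlin : linear (fun c : 'rV[K]_m => u (c *m A)).
  by move=> x c d; rewrite mulmxDl -scalemxAl linearP.
pose v : {linear 'rV[K]_m -> W} :=
  HB.pack (fun c : 'rV[K]_m => u (c *m A)) (GRing.isLinear.Build _ _ _ _ _ vlin).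
have vi : injective v by exact: can_inj pK.
have CC : (C * C)%:E = (C%:E * C%:E)%E by rewrite EFinM.
have C2max : ((C * C)%:E <= (Num.max (C * C) 1)%:E)%E.
  by rewrite lee_fin le_max lexx.
exists (range v), m; split.
- exact: has_dim_range.
- by move=> _ [c _ <-]; exists (c *m A).
- by apply: le_trans dm; rewrite ler_wpM2r // ge_min lexx.
- apply: le_trans C2max; rewrite CC.
  apply: (@le_trans _ _ (opnorm (range v) (@rnorm R k W) (@l2norm R k m) p *
          opnorm [set: 'rV[K]_m] (@l2norm R k m) (@rnorm R k W) v)%E).
    apply: ereal_inf_lbound; exists p, v; split; last by [].
    - by split=> a x y _ _; rewrite linearP.
    - by split=> [//|y _]; exists y.
    - by split=> [_ [c _ <-]|c _]; rewrite /= pK.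
  apply: lee_pmul.
  + apply: (@opnorm_ge0 _ _ _ _ _ _ 0); rewrite ?linear0 ?l2norm0 ?rnorm0 //.
    by exists 0; rewrite ?linear0.
  + by apply: (@opnorm_ge0 _ _ _ _ _ _ 0); rewrite ?linear0 ?l2norm0 ?rnorm0.
  + by apply: opnorm_le.
  + by apply: opnorm_le => // c _; exact: vC.
- exists (v \o p); split=> [w|_ [c _ <-]|]; first by exists (p w).
    by rewrite /= pK.
  apply: le_trans C2max; apply: opnorm_le => [|w _]; first exact: mulr_ge0.
  rewrite /= (le_trans (vC _)) // -mulrA ler_wpM2l //.
Qed.

Lemma weak_hilbertP (W : normedModType K) :
  weak_hilbert W <-> hilbert_factorization W.
Proof.
split; [exact: hilbert_factorization_intro | exact: hilbert_factorization_elim].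
Qed.

(** The weak Hilbert property passes to all subspaces, complemented or not, since
    the projections restrict. *)
Lemma hilbert_factorization_subspace (X Z : normedModType K) (j : {linear X -> Z})
    (a b : R) : 0 < a -> 0 <= b ->
    (forall x, a * rnorm x <= rnorm (j x)) -> (forall x, rnorm (j x) <= b * rnorm x) ->
  hilbert_factorization Z -> hilbert_factorization X.
Proof.
move=> a0 b0 ja jb [delta [C [delta0 C0 wh]]].
have ab0 : 0 <= a^-1 + b by rewrite addr_ge0 ?invr_ge0 // ltW.
exists delta, (C * (a^-1 + b)); split=> // [|n u ui]; first by rewrite mulr_ge0.
have ji : injective j.
  move=> x y /eqP; rewrite -subr_eq0 -linearB => /eqP jxy.
  apply/eqP; rewrite -subr_eq0; apply/eqP/rnorm_eq0/le_anti.
  rewrite rnorm_ge0 andbT -(pmulr_rle0 _ a0).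
  by rewrite (le_trans (ja _)) // jxy rnorm0.
have [m dm [A [p [pK vC pC]]]] := wh n (j \o u) (inj_comp ji ui).
exists m => //; exists A, (p \o j); split=> [c|c|w]; first exact: pK.
- have := le_trans (ja _) (vC c); rewrite -ler_pdivlMl // => h.
  rewrite (le_trans h) // mulrA ler_wpM2r ?l2norm_ge0 // mulrC ler_wpM2l //.
  by rewrite lerDl.
- rewrite (le_trans (pC _)) // -mulrA ler_wpM2l // (le_trans (jb _)) //.
  by rewrite ler_wpM2r ?rnorm_ge0 // lerDr invr_ge0 ltW.
Qed.

End Factorization.

(** * Finite sums of copies of a weak Hilbert space *)

Section FiniteSums.
Variables (R : realType) (k : scalar_kind).
Local Notation K := (scalars R k).

(** Rank-nullity: a maximal subspace H of the kernel has a complement on which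
    the map is injective, and one of the two has at least half the dimension. *)
Lemma kernel_or_injective_half (V : lmodType K) m (g : {linear 'rV[K]_m -> V}) :
  exists h (H : 'M[K]_(h, m)), [/\ row_free H, (m <= 2 * h)%N &
    (forall c, g (c *m H) = 0) \/ injective (g \o mulmxr H)].
Proof.
pose P h := `[< exists2 H : 'M[K]_(h, m), row_free H & forall c, g (c *m H) = 0 >].
have P0 : exists h, P h.
  exists 0%N; apply/asboolP; exists 0; first by rewrite -row_leq_rank.
  by move=> c; rewrite mulmx0 linear0.
have Pm h : P h -> (h <= m)%N.
  by move=> /asboolP[H Hf _]; rewrite -(eqP Hf) rank_leq_col.
case: (ex_maxnP P0 Pm) => h /asboolP[H Hf gH] hmax.
have [le|lt] := leqP m (2 * h).
  by exists h, H; split=> //; left.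
exists (\rank H^C%MS), (row_base H^C%MS); split.
- exact: row_base_free.
- by rewrite mxrank_compl (eqP Hf); lia.
right; set H' := row_base _.
have H'f : row_free H' by exact: row_base_free.
suff inj0 c : g (c *m H') = 0 -> c = 0.
  move=> c d /= /eqP; rewrite -subr_eq0 -linearB /= -mulmxBl => /eqP /inj0 /eqP.
  by rewrite subr_eq0 => /eqP.
move=> gc; apply: contrapT => /eqP cn0.
suff : P (h + 1)%N by move=> /hmax; rewrite addn1 ltnn.
apply/asboolP; exists (col_mx H (c *m H')); last first.
  move=> d; rewrite -[d]hsubmxK mul_row_col linearD /= gH add0r.
  by rewrite [rsubmx d]mx11_scalar mul_scalar_mx linearZ /= gc scaler0.
apply: inj_row_free => d; rewrite -[d]hsubmxK mul_row_col => e.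
set x := lsubmx d in e *; set t := rsubmx d in e *.
have z0 : t *m (c *m H') = 0.
  apply/eqP; rewrite -submx0 -(capmx_compl H) sub_capmx; apply/andP; split.
    move: e => /eqP; rewrite addrC addr_eq0 => /eqP ->.
    by rewrite -mulNmx submxMl.
  by rewrite mulmxA; apply: (submx_trans (submxMl _ _)); rewrite eq_row_base.
have x0 : x = 0 by apply: (row_free_eq0 Hf); rewrite -e z0 addr0.
have t0 : t = 0.
  have : t *m c = 0 by apply: (row_free_eq0 H'f); rewrite -mulmxA.
  rewrite [t]mx11_scalar mul_scalar_mx => /eqP.
  by rewrite scaler_eq0 (negPf cn0) orbF => /eqP ->; rewrite raddf0.
by rewrite x0 t0 row_mx0.
Qed.

Section Sum.
Variables (Y W : normedModType K) (n : nat).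
Variables (a : 'I_n -> {linear Y -> W}) (b : 'I_n -> {linear W -> Y}).
Variables (M delta C : R).
Hypothesis M0 : 0 <= M.
Hypothesis aM : forall i y, rnorm (a i y) <= M * rnorm y.
Hypothesis bM : forall i w, rnorm (b i w) <= M * rnorm w.
Hypothesis abK : forall w, w = \sum_i a i (b i w).
Hypotheses (delta0 : 0 < delta) (C0 : 0 <= C).
Hypothesis facY : forall m (u : {linear 'rV[K]_m -> Y}), injective u ->
  exists2 h : nat, delta * m%:R <= h%:R & factors_identity C u h.

Let D := C * (1 + M).
Let q := Num.min delta 1 / 4.

Let C_le_D : C <= D. Proof. by rewrite ler_peMr // lerDl. Qed.
Let D_ge0 : 0 <= D. Proof. exact: le_trans C0 C_le_D. Qed.
Let CM_le_D : C * M <= D. Proof. by rewrite ler_wpM2l // lerDr. Qed.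
Let q_gt0 : 0 < q.
Proof. by rewrite divr_gt0 // lt_min delta0 ltr01. Qed.

(** The invariant of an induction on j, for the subspace spanned by the rows of A:
    either the first j maps b_i vanish on it, or they are all bounded for one
    Euclidean norm, in which the subspace is complemented in W.  The constant D
    is the same at all stages; only the dimension decreases. *)
Definition controlled j N (u : {linear 'rV[K]_N -> W}) m (A : 'M[K]_(m, N)) :=
  row_free A /\
  ((forall (i : 'I_n) c, (i < j)%N -> b i (u (c *m A)) = 0) \/
   exists p : {linear W -> 'rV[K]_m},
     [/\ forall c, p (u (c *m A)) = c,
         forall w, l2norm (p w) <= D * rnorm w &
         forall (i : 'I_n) c, (i < j)%N -> rnorm (b i (u (c *m A))) <= D * l2norm c]).

(** With an orthonormal basis of the smaller subspace, the projection onto it costs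
    nothing. *)
Lemma controlled_restrict j N (u : {linear 'rV[K]_N -> W}) m (A : 'M[K]_(m, N))
    h (H : 'M[K]_(h, m)) : row_free H -> controlled j u A ->
  exists G : 'M[K]_(h, m), (G <= H)%MS /\ controlled j u (G *m A).
Proof.
move=> Hf [Af [zero|[p [pK pD bD]]]].
  exists H; split=> //; split; first exact: row_free_mulmx.
  by left=> i c ij; rewrite mulmxA zero.
have [G Gu GH] := orthonormalization Hf.
exists (G *m H); split; first exact: submxMl.
split; first by rewrite !row_free_mulmx ?row_free_unit.
right; exists (mulmxr (adj (G *m H)) \o p); split=> [c|w|i c ij].
- by rewrite /= mulmxA pK -mulmxA GH mulmx1.
- by rewrite (le_trans (l2norm_coisometry _ GH)).
- by rewrite mulmxA (le_trans (bD _ _ ij)) // (l2norm_isometry _ GH).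
Qed.

(** If b_j vanishes on half of the subspace, pass to that half.  Otherwise b_j is
    injective on half of it, and a factorization through Y provides a second
    Euclidean norm, for which b_j is bounded; on half of the remaining subspace
    one of the two Euclidean norms dominates the other, and it serves for all
    the b_i. *)
Lemma controlled_step j (jn : (j < n)%N) N (u : {linear 'rV[K]_N -> W})
    m (A : 'M[K]_(m, N)) : injective u -> controlled j u A ->
  exists h (B : 'M[K]_(h, m)), q * m%:R <= h%:R /\ controlled j.+1 u (B *m A).
Proof.
move=> ui cA; pose ij := Ordinal jn.
have below (i : 'I_n) : (i < j.+1)%N -> i = ij \/ (i < j)%N.
  by rewrite ltnS leq_eqVlt => /orP[/eqP e|]; [left; exact: val_inj|right].
have q4 : q <= 4^-1.
  by rewrite /q ler_pdivrMr // mulVf ?pnatr_eq0 // ge_min lexx orbT.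
have qd : q <= delta / 4 by rewrite ler_wpM2r // ge_min lexx.
have halfR r s : (r <= 2 * s)%N -> r%:R <= 2 * s%:R :> R.
  by move=> rs; rewrite -natrM ler_nat.
have [h [H [Hf mh gH]]] := kernel_or_injective_half (b ij \o (u \o mulmxr A)).
have {}mh := halfR _ _ mh.
have m0 : 0 <= m%:R :> R by exact: ler0n.
case: gH => [gker|ginj].
  have [G [/submxP[X GE] cG]] := controlled_restrict Hf cA.
  exists h, G; split; first by nra.
  have [Gf cG'] := cG; split=> //.
  have bij c : b ij (u (c *m (G *m A))) = 0 by rewrite GE !mulmxA; exact: gker.
  case: cG' => [zero|[p [pK pD bD]]].
    by left=> i c /below[->|]; [exact: bij|exact: zero].
  right; exists p; split=> // i c /below[->|]; last exact: bD.
  by rewrite bij rnorm0 mulr_ge0 ?l2norm_ge0 ?D_ge0.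
have [r dr [A' [p [pK vC pC]]]] :=
  facY (u := (b ij \o (u \o mulmxr A)) \o mulmxr H) ginj.
have qmr : q * m%:R <= r%:R / 2.
  have := ler_wpM2l (ltW delta0) mh; have := ler_wpM2r m0 qd; lra.
pose B := A' *m H.
have {}pK c : p (b ij (u (c *m B *m A))) = c by rewrite /B mulmxA; exact: pK.
have {}vC c : rnorm (b ij (u (c *m B *m A))) <= C * l2norm c.
  by rewrite /B mulmxA; exact: vC.
have Bf : row_free B.
  by apply: inj_row_free => c c0; rewrite -(pK c) c0 mul0mx !linear0.
have pbD w : l2norm (p (b ij w)) <= D * rnorm w.
  rewrite (le_trans (pC _)) // (le_trans (ler_wpM2l C0 (bM _ _))) //.
  by rewrite mulrA ler_wpM2r ?rnorm_ge0 ?CM_le_D.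
have Af := cA.1.
clearbody B.
case: cA => _ [zero|[p' [pK' pD' bD']]].
  exists r, B; split; first by rewrite (le_trans qmr) // ler_piMr // invf_le1 ?ler1n.
  split; first exact: row_free_mulmx.
  right; exists (p \o b ij); split=> [c|w|i c /below[->|/zero i0]].
  - by rewrite /= mulmxA pK.
  - exact: pbD.
  - by rewrite mulmxA (le_trans (vC _)) // ler_wpM2r ?l2norm_ge0 ?C_le_D.
  - by rewrite mulmxA i0 rnorm0 mulr_ge0 ?l2norm_ge0 ?D_ge0.
have [s [J [rs dom]]] := dominating_half Bf.
have {}rs := halfR _ _ rs.
exists s, (J *m B); split; first by lra.
case: dom => [[JJ le]|[JJ le]]; split.
- have Jf : row_free J.
    by apply/row_freeP; exists (adj J).
  exact: (row_free_mulmx (row_free_mulmx Jf Bf) Af).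
- right; exists (mulmxr (adj J) \o (p \o b ij)); split=> [c|w|i c /below[->|ij']].
  + by rewrite /= !mulmxA pK -mulmxA JJ mulmx1.
  + by rewrite (le_trans (l2norm_coisometry _ JJ)) ?pbD.
  + rewrite !mulmxA (le_trans (vC _)) // (l2norm_isometry _ JJ).
    by rewrite ler_wpM2r ?l2norm_ge0 ?C_le_D.
  + by rewrite !mulmxA (le_trans (bD' _ _ ij')) // ler_wpM2l ?D_ge0.
- have JBf : row_free (J *m B) by apply/row_freeP; exists (adj (J *m B)).
  exact: (row_free_mulmx JBf Af).
- right; exists (mulmxr (adj (J *m B)) \o p'); split=> [c|w|i c /below[->|ij']].
  + by rewrite /= mulmxA pK' -mulmxA JJ mulmx1.
  + by rewrite (le_trans (l2norm_coisometry _ JJ)) ?pD'.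
  + rewrite !mulmxA (le_trans (vC _)) // (le_trans (ler_wpM2l C0 (le _))) //.
    by rewrite ler_wpM2r ?l2norm_ge0 ?C_le_D.
  + by rewrite mulmxA (le_trans (bD' _ _ ij')) // (l2norm_isometry _ JJ).
Qed.

Lemma controlled_exists j N (u : {linear 'rV[K]_N -> W}) : injective u -> (j <= n)%N ->
  exists m (A : 'M[K]_(m, N)), q ^+ j * N%:R <= m%:R /\ controlled j u A.
Proof.
move=> ui; elim: j => [_|j IHj jn].
  exists N, 1%:M; split; first by rewrite expr0 mul1r.
  by split; [rewrite row_free_unit unitmx1|left].
have [m [A [qm cA]]] := IHj (ltnW jn).
have [h [B [qh cB]]] := controlled_step jn ui cA.
exists h, (B *m A); split=> //.
by rewrite exprS -mulrA (le_trans _ qh) // ler_wpM2l // ltW ?q_gt0.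
Qed.

Lemma sum_factors_identity N (u : {linear 'rV[K]_N -> W}) : injective u ->
  exists2 m : nat, q ^+ n * N%:R <= m%:R & factors_identity (D + n%:R * (M * D)) u m.
Proof.
move=> ui; have [m [A [qm [Af cA]]]] := controlled_exists ui (leqnn n).
have MD0 : 0 <= n%:R * (M * D) by exact: mulr_ge0 (ler0n _ _) (mulr_ge0 M0 D_ge0).
have D'0 : 0 <= D + n%:R * (M * D) := addr_ge0 D_ge0 MD0.
exists m => //; case: cA => [zero|[p [pK pD bD]]].
  case: m A qm Af zero => [|m] A qm Af zero; first exact: factors_identity0.
  have : delta_mx 0 0 = 0 :> 'rV[K]_m.+1.
    apply: (row_free_eq0 Af); apply: ui; rewrite linear0 [LHS]abK big1 // => i _.
    by rewrite zero ?linear0.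
  by move=> /matrixP /(_ 0 0) /eqP; rewrite !mxE !eqxx oner_eq0.
exists A, p; split=> // [c|w].
  rewrite [X in rnorm X]abK (le_trans (rnorm_sum _ _ _)) //.
  apply: (@le_trans _ _ (\sum_(i < n) M * (D * l2norm c))).
    by apply: ler_sum => i _; rewrite (le_trans (aM _ _)) // ler_wpM2l // bD.
  rewrite sumr_const card_ord -[X in X <= _]mulr_natl mulrDl !mulrA lerDr.
  by rewrite mulr_ge0 ?D_ge0 ?l2norm_ge0.
by rewrite (le_trans (pD w)) // ler_wpM2r ?rnorm_ge0 // lerDl.
Qed.

End Sum.

(** After the last step the Euclidean norm controls all b_i, hence the norm,
    as sum_i a_i b_i is the identity of W; if all b_i vanish, the subspace is zero. *)
Theorem hilbert_factorization_sum (Y W : normedModType K) n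
    (a : 'I_n -> {linear Y -> W}) (b : 'I_n -> {linear W -> Y}) (M : R) :
    0 <= M -> (forall i y, rnorm (a i y) <= M * rnorm y) ->
    (forall i w, rnorm (b i w) <= M * rnorm w) -> (forall w, w = \sum_i a i (b i w)) ->
  hilbert_factorization Y -> hilbert_factorization W.
Proof.
move=> M0 aM bM abK [delta [C [delta0 C0 facY]]].
exists ((Num.min delta 1 / 4) ^+ n), (C * (1 + M) + n%:R * (M * (C * (1 + M)))).
split; first by rewrite exprn_gt0 // divr_gt0 // lt_min delta0 ltr01.
  by rewrite !(addr_ge0, mulr_ge0).
by move=> N u; exact: (sum_factors_identity M0 aM bM abK delta0 C0 facY).
Qed.

End FiniteSums.

(** * Injective and projective tensor products *)

Section Tensor.
Variables (R : realType) (k : scalar_kind).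
Local Notation K := (scalars R k).

Section Lift.
Variables (X Y V : lmodType K) (b : {bilinear X -> Y -> V}).

Definition tensor_lift (w : tensor X Y) : V := bilin_sum b (repr w).

Fact tensor_lift_linear : linear tensor_lift.
Proof.
move=> a u v; rewrite /tensor_lift bilin_sum_repr bilin_sum_cat.
by rewrite !bilin_sum_repr bilin_sum_scale.
Qed.

HB.instance Definition _ :=
  GRing.isLinear.Build K (tensor X Y) V *:%R tensor_lift tensor_lift_linear.

Lemma tensor_lift_class s : tensor_lift (tensor_class s) = bilin_sum b s.
Proof. exact: bilin_sum_repr. Qed.

Lemma tensor_lift_pure x y : tensor_lift (pure x y) = b x y.
Proof. by rewrite tensor_lift_class /bilin_sum big_seq1. Qed.

End Lift.

Lemma dual_ballP (X : normedModType K) (f : {linear X -> K^o}) :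
  dual_ball f <-> forall x, rnorm (f x) <= rnorm x.
Proof.
split=> [df x|df].
  by rewrite (le_trans (opnorm_linear_bound x df)) // mul1r.
by apply: opnorm_le => // x _; rewrite mul1r.
Qed.

Section SliceMap.
Variables (X Y : normedModType K) (f : {linear X -> K^o}).

Let slice_form (x : X) (y : Y) : Y := (f x : K) *: y.

Fact slice_form_bilinear : bilinear_for *:%R *:%R slice_form.
Proof.
split=> [y a x x'|x a y y']; rewrite /slice_form.
  by rewrite linearP scalerDl; congr (_ + _); rewrite [RHS]scalerA.
by rewrite scalerDr; congr (_ + _); rewrite scalerA mulrC [RHS]scalerA.
Qed.

HB.instance Definition _ := bilinear_isBilinear.Build K X Y Y *:%R *:%R
  slice_form slice_form_bilinear.

(** f (x) id, with values in K (x) Y = Y. *)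
Definition slice : {linear tensor X Y -> Y} := tensor_lift slice_form.

Lemma slice_pure x y : slice (pure x y) = (f x : K) *: y.
Proof. exact: tensor_lift_pure. Qed.

Lemma slice_class s : slice (tensor_class s) = \sum_(p <- s) (f p.1 : K) *: p.2.
Proof. exact: tensor_lift_class. Qed.

End SliceMap.
Arguments slice {X Y} f.

Section Norms.
Variables (alpha : tensor_norm_kind) (X Y : normedModType K).
Variables (Z : normedModType K) (iota : {linear tensor X Y -> Z}).
Hypothesis iota_norm : forall w, (rnorm (iota w))%:E = tensor_norm alpha w.

Lemma rnorm_pure_le x y : rnorm (iota (pure x y)) <= rnorm x * rnorm y.
Proof.
rewrite -lee_fin iota_norm; case: alpha => /=.
  apply: ge_ereal_sup => _ [f [g [/dual_ballP df /dual_ballP dg ->]]].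
  rewrite functional_sum_repr big_seq1 lee_fin /=.
  rewrite [leLHS](rnormM (f x : K) (g y : K)).
  by rewrite ler_pM ?rnorm_ge0 ?df ?dg.
apply: ereal_inf_lbound; exists [:: (x, y)]; last by rewrite big_seq1.
by rewrite /= big_seq1.
Qed.

(** For the injective norm this is the definition; for the projective norm it is
    the comparison of the two norms. *)
Lemma rnorm_functional_le (f : {linear X -> K^o}) (g : {linear Y -> K^o}) s :
    (forall x, rnorm (f x) <= rnorm x) -> (forall y, rnorm (g y) <= rnorm y) ->
  rnorm (\sum_(p <- s) f p.1 * g p.2 : K) <= rnorm (iota (tensor_class s)).
Proof.
move=> df dg; rewrite -lee_fin iota_norm; case: alpha => /=.
  apply: ereal_sup_ubound; exists f, g; split; [exact/dual_ballP|exact/dual_ballP|].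
  by rewrite functional_sum_repr.
apply: le_ereal_inf_tmp => _ [t /= wt <-]; rewrite lee_fin.
rewrite -tensor_class_sum in wt.
rewrite -(functional_sum_repr f g s) wt functional_sum_repr.
apply: le_trans (rnorm_sum _ _ _) _; apply: ler_sum => p _.
by rewrite rnormM ler_pM ?rnorm_ge0 ?df ?dg.
Qed.

(** The norm of the slice is attained on a functional g of the dual ball, and
    g of the slice is the value of f (x) g. *)
Lemma rnorm_slice_le (f : {linear X -> K^o}) w :
  (forall x, rnorm (f x) <= rnorm x) -> rnorm (slice f w) <= rnorm (iota w).
Proof.
move=> df; have [g [dg gw]] := hahn_banach (slice f w).
apply: (le_trans gw); have := rnorm_functional_le (repr w) df dg.
rewrite tensor_reprK; apply: le_trans.
rewrite -{1}(tensor_reprK w) slice_class linear_sum.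
rewrite le_eqVlt; apply/orP; left; apply/eqP; congr rnorm.
by apply: eq_bigr => p _; rewrite linearZ.
Qed.

End Norms.

Lemma rnorm_projective_le (X Y Z : normedModType K) (iota : {linear tensor X Y -> Z})
    (V : normedModType K) (b : {bilinear X -> Y -> V}) (M : R) w :
    (forall w, (rnorm (iota w))%:E = tensor_norm Projective w) -> 0 < M ->
    (forall x y, rnorm (b x y) <= M * (rnorm x * rnorm y)) ->
  rnorm (tensor_lift b w) <= M * rnorm (iota w).
Proof.
move=> iota_norm M0 bM; rewrite -ler_pdivrMl // -lee_fin iota_norm.
apply: le_ereal_inf_tmp => _ [s /= ws <-]; rewrite lee_fin ler_pdivrMl //.
rewrite -tensor_class_sum in ws; rewrite ws tensor_lift_class mulr_sumr.
by apply: le_trans (rnorm_sum _ _ _) _; apply: ler_sum => p _.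
Qed.

Section Swap.
Variables (X Y : normedModType K).

Let pure_swap (y : Y) (x : X) : tensor X Y := pure x y.

Fact pure_swap_bilinear : bilinear_for *:%R *:%R pure_swap.
Proof.
by split=> [x a y y'|y a x x']; rewrite /pure_swap ?linearPr ?linearPl.
Qed.

HB.instance Definition _ := bilinear_isBilinear.Build K Y X (tensor X Y) *:%R *:%R
  pure_swap pure_swap_bilinear.

Definition tensor_swap : {linear tensor Y X -> tensor X Y} := tensor_lift pure_swap.

Lemma tensor_swap_class s :
  tensor_swap (tensor_class s) = tensor_class [seq (p.2, p.1) | p <- s].
Proof. by rewrite [LHS]tensor_lift_class tensor_class_sum big_map. Qed.

End Swap.
Arguments tensor_swap {X Y}.

Lemma tensor_swapK (X Y : normedModType K) :
  cancel (@tensor_swap X Y) (@tensor_swap Y X).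
Proof.
move=> w; rewrite -(tensor_reprK w) !tensor_swap_class -map_comp.
by rewrite -[in RHS](map_id (repr w)); congr tensor_class; apply: eq_map => -[].
Qed.

Lemma tensor_norm_swap_le alpha (X Y : normedModType K) (w : tensor Y X) :
  (tensor_norm alpha (tensor_swap w) <= tensor_norm alpha w)%E.
Proof.
rewrite -{1}(tensor_reprK w) tensor_swap_class.
case: alpha => /=.
  apply: ge_ereal_sup => _ [f [g [df dg ->]]]; apply: ereal_sup_ubound.
  exists g, f; split=> //; rewrite functional_sum_repr big_map.
  by congr (rnorm _)%:E; apply: eq_bigr => p _; rewrite mulrC.
apply: le_ereal_inf_tmp => _ [s /= ws <-]; apply: ereal_inf_lbound.
exists [seq (p.2, p.1) | p <- s]; last first.
  by rewrite big_map; congr EFin; apply: eq_bigr => p _; rewrite mulrC.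
rewrite /= -tensor_class_sum -!tensor_swap_class tensor_reprK.
by rewrite ws -tensor_class_sum.
Qed.

Lemma is_completed_tensor_swap alpha (X Y : normedModType K)
    (Z : completeNormedModType K) (iota : {linear tensor X Y -> Z}) :
  is_completed_tensor alpha iota ->
  is_completed_tensor alpha (iota \o @tensor_swap X Y : {linear _ -> _}).
Proof.
move=> [norm dense]; split=> [w|].
  rewrite /= norm; apply/le_anti; rewrite tensor_norm_swap_le /=.
  by rewrite -{1}(tensor_swapK w) tensor_norm_swap_le.
suff -> : range (iota \o @tensor_swap X Y) = range iota by [].
apply/seteqP; split=> _ [w _ <-]; first by exists (tensor_swap w).
by exists (tensor_swap w); rewrite //= tensor_swapK.
Qed.

(** The map y |-> x0 (x) y embeds Y into the tensor product, with the slice along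
    a functional norming x0 as a left inverse up to a scalar. *)
Lemma hilbert_factorization_factor alpha (X Y : normedModType K)
    (Z : completeNormedModType K) (iota : {linear tensor X Y -> Z}) (x0 : X) :
    x0 != 0 -> is_completed_tensor alpha iota ->
  hilbert_factorization Z -> hilbert_factorization Y.
Proof.
move=> x00 [norm _].
have x0pos : 0 < rnorm x0.
  rewrite lt_neqAle rnorm_ge0 andbT eq_sym; apply: contra x00 => /eqP x0E.
  exact/eqP/rnorm_eq0.
have [f [df fx0]] := hahn_banach x0.
have jlin : linear (fun y : Y => iota (pure x0 y)).
  by move=> a y y'; rewrite linearPr linearP.
pose j : {linear Y -> Z} :=
  HB.pack (fun y : Y => iota (pure x0 y)) (GRing.isLinear.Build _ _ _ _ _ jlin).
apply: (hilbert_factorization_subspace (j := j) x0pos (ltW x0pos)) => y.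
  have := rnorm_slice_le norm (pure x0 y) df; apply: le_trans.
  by rewrite slice_pure rnormZ ler_wpM2r ?rnorm_ge0.
exact: (rnorm_pure_le norm).
Qed.

End Tensor.
Arguments slice {R k X Y} f.
Arguments tensor_swap {R k X Y}.

(** * Two infinite-dimensional factors *)

Section InfiniteFactors.
Variables (R : realType) (k : scalar_kind).
Local Notation K := (scalars R k).

Lemma trace_cauchy_schwarz m n (A : 'M[K]_(m, n)) (B : 'M[K]_(n, m)) :
  A *m B = 1%:M ->
  m%:R ^+ 2 <= (\sum_j l2norm (row j A^T) ^+ 2) * (\sum_j l2norm (row j B) ^+ 2) :> R.
Proof.
move=> AB.
have sumE (C : 'M[K]_(n, m)) :
    \sum_j l2norm (row j C) ^+ 2 = \sum_p rnorm (C p.1 p.2 : K) ^+ 2.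
  rewrite -(pair_bigA _ (fun j i => rnorm (C j i : K) ^+ 2)) /=.
  by apply: eq_bigr => j _; rewrite l2norm_sqr; apply: eq_bigr => i _; rewrite mxE.
rewrite !sumE; apply: le_trans (cauchy_schwarz _ _).
rewrite ler_sqr ?nnegrE ?ler0n //; last first.
  by apply: sumr_ge0 => p _; rewrite mulr_ge0 ?rnorm_ge0.
have -> : m%:R = rnorm (\sum_p A^T p.1 p.2 * B p.1 p.2 : K).
  have : \tr (A *m B) = m%:R by rewrite AB mxtrace1.
  rewrite mxtrace_mulC /mxtrace => e.
  rewrite -(pair_bigA _ (fun j i => A^T j i * B j i)) /=.
  transitivity (rnorm (m%:R : K)).
    by rewrite -(rmorph_nat (of_real k)) rnorm_of_real normr_nat.
  congr rnorm; rewrite -e; apply: eq_bigr => j _; rewrite !mxE.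
  by apply: eq_bigr => i _; rewrite mxE mulrC.
apply: le_trans (rnorm_sum _ _ _) _; apply: ler_sum => p _.
by rewrite rnormM.
Qed.

Lemma l2norm_parallelogram n (v w : 'rV[K]_n) :
  l2norm (v + w) ^+ 2 + l2norm (v - w) ^+ 2 = 2 * (l2norm v ^+ 2 + l2norm w ^+ 2).
Proof.
rewrite !l2norm_sqr -!big_split mulr_sumr; apply: eq_bigr => i _ /=.
rewrite !mxE mulr_natl mulr2n; apply: (@of_real_inj R k).
rewrite !rmorphD /= -!mul_conj !rmorphD !rmorphN /=.
by ring.
Qed.

(** Choosing the signs one after the other: by the parallelogram identity one of
    the two signs does not decrease the sum of the squares. *)
Lemma sign_choice n m (r : 'I_n -> 'rV[K]_m) : exists s : 'I_n -> bool,
  \sum_j l2norm (r j) ^+ 2 <= l2norm (\sum_j (-1) ^+ s j *: r j) ^+ 2.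
Proof.
elim: (index_enum _) (index_enum_uniq 'I_n) => [_|j l IHl /= /andP[jl ul]].
  by exists (fun=> false); rewrite !big_nil sqr_ge0.
have [s le] := IHl ul.
have [b lb] : exists b : bool, l2norm (r j) ^+ 2 + l2norm (\sum_(i <- l) (-1) ^+ s i *: r i) ^+ 2
    <= l2norm ((-1) ^+ b *: r j + \sum_(i <- l) (-1) ^+ s i *: r i) ^+ 2.
  set v := \sum_(i <- l) _; have := l2norm_parallelogram v (r j).
  have [h _|h e] := leP (l2norm (r j) ^+ 2 + l2norm v ^+ 2) (l2norm (v + r j) ^+ 2).
    by exists false; rewrite expr0 scale1r [r j + v]addrC.
  exists true; rewrite expr1 scaleN1r [- r j + v]addrC; lra.
exists (fun i => if i == j then b else s i).
rewrite !big_cons eqxx (le_trans (lerD (lexx _) le)) // (le_trans lb) //.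
rewrite le_eqVlt; apply/orP; left; apply/eqP; congr (l2norm (_ + _) ^+ 2).
rewrite !big_seq; apply: eq_bigr => i il; case: eqP => // ij.
by rewrite ij (negPf jl) in il.
Qed.

(** Test the hypothesis on the conjugate of f. *)
Lemma l2norm_dual n (f : 'rV[K]_n) (C : R) : 0 <= C ->
  (forall c : 'rV[K]_n, rnorm (\sum_i c 0 i * f 0 i : K) <= C * l2norm c) ->
  l2norm f <= C.
Proof.
move=> C0 /(_ (map_mx (@conj R k) f)).
have -> : \sum_i map_mx (@conj R k) f 0 i * f 0 i = of_real k (l2norm f ^+ 2).
  rewrite l2norm_sqr rmorph_sum; apply: eq_bigr => i _.
  by rewrite mxE mulrC mul_conj.
have -> : l2norm (map_mx (@conj R k) f) = l2norm f.
  by rewrite /l2norm; congr Num.sqrt; apply: eq_bigr => i _; rewrite mxE rnorm_conj.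
rewrite rnorm_of_real ger0_norm ?sqr_ge0 // expr2.
have := l2norm_ge0 f; rewrite le_eqVlt => /orP[/eqP <- //|f0].
by rewrite ler_pM2r.
Qed.

Lemma infinite_independent (V : lmodType K) : ~ finite_dimensional V ->
  forall n, exists u : {linear 'rV[K]_n -> V}, injective u.
Proof.
move=> nfd; elim=> [|n [u ui]].
  by exists \0 => c d _; rewrite [c]thinmx0 [d]thinmx0.
have [x nx] : exists x, ~ range u x.
  apply: contrapT => /forallNP h; apply: nfd; exists n.
  have <- : range u = [set: V].
    by apply/seteqP; split=> // x _; apply: contrapT; exact: h.
  exact: has_dim_range.
have wlin : linear (fun c : 'rV[K]_(n + 1) => u (lsubmx c) + rsubmx c 0 0 *: x).
  move=> a c d; rewrite !linearP /= !mxE scalerDl scalerDr scalerA.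
  by rewrite addrACA.
have -> : n.+1 = (n + 1)%N by rewrite addn1.
exists (HB.pack (fun c : 'rV[K]_(n + 1) => u (lsubmx c) + rsubmx c 0 0 *: x)
  (GRing.isLinear.Build _ _ _ _ _ wlin) : {linear _ -> _}).
apply: raddf_inj => c /=.
have [r0|r0] := eqVneq (rsubmx c 0 0) 0.
  rewrite r0 scale0r addr0 -[RHS](linear0 u) => /ui l0.
  rewrite -[c]hsubmxK l0 [rsubmx c]mx11_scalar r0 raddf0 row_mx0 //.
move=> e; case: nx; exists (- (rsubmx c 0 0)^-1 *: lsubmx c) => //.
rewrite linearZ /=; move/eqP: e; rewrite addr_eq0 => /eqP ->.
by rewrite scalerN scaleNr opprK scalerA mulVf // scale1r.
Qed.

(** Restricting a factorisation of the identity of l2^m to the first n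
    coordinates. *)
Lemma infinite_l2_copies (X : normedModType K) :
  ~ finite_dimensional X -> hilbert_factorization X ->
  exists2 C : R, 1 <= C & forall n, exists (v : {linear 'rV[K]_n -> X})
      (p : {linear X -> 'rV[K]_n}),
    [/\ forall c, p (v c) = c, forall c, rnorm (v c) <= C * l2norm c &
        forall x, l2norm (p x) <= C * rnorm x].
Proof.
move=> nfd [delta [C [delta0 C0 fac]]]; exists (C + 1); first by rewrite lerDr.
move=> n; pose N := (Num.trunc (n%:R / delta : R)).+1.
have [u ui] := infinite_independent nfd N.
have [m dm [A [p [pK vC pC]]]] := fac N u ui.
have nm : (n <= m)%N.
  rewrite -(ler_nat R); apply: le_trans dm; rewrite mulrC -ler_pdivrMr //.
  by rewrite ltW // truncnS_gt.
pose J : 'M[K]_(n, m) := pid_mx n.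
have JJ : J *m adj J = 1%:M.
  have -> : adj J = pid_mx n.
    by apply/matrixP => i j; rewrite !mxE rmorph_nat eq_sym; case: eqP => //= ->.
  by rewrite mul_pid_mx minnn (minn_idPr nm) pid_mx_1.
exists (u \o mulmxr (J *m A)), (mulmxr (adj J) \o p); split=> [c|c|x] /=.
- by rewrite mulmxA pK -mulmxA JJ mulmx1.
- rewrite mulmxA (le_trans (vC _)) // (l2norm_isometry _ JJ).
  by rewrite ler_wpM2r ?l2norm_ge0 // lerDl.
- rewrite (le_trans (l2norm_coisometry _ JJ)) // (le_trans (pC _)) //.
  by rewrite ler_wpM2r ?rnorm_ge0 // lerDl.
Qed.

Lemma l2norm_functional_row (X : normedModType K) n (v : {linear 'rV[K]_n -> X})
    (f : {linear X -> K^o}) (C : R) : 0 <= C ->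
    (forall x, rnorm (f x) <= rnorm x) -> (forall c, rnorm (v c) <= C * l2norm c) ->
  l2norm (\row_j (f (v (delta_mx 0 j)) : K)) <= C.
Proof.
move=> C0 df vC; apply: l2norm_dual => // c.
apply: le_trans (vC c); apply: le_trans (df _).
rewrite [v c]lincombE linear_sum le_eqVlt; apply/orP; left; apply/eqP.
by congr rnorm; apply: eq_bigr => i _; rewrite mxE linearZ.
Qed.

Lemma coordinate_functional (X : normedModType K) n (p : {linear X -> 'rV[K]_n})
    (C : R) j : 0 < C -> (forall x, l2norm (p x) <= C * rnorm x) ->
  exists2 f : {linear X -> K^o}, forall x, rnorm (f x) <= rnorm x &
    forall x, (f x : K) = of_real k C^-1 * p x 0 j.
Proof.
move=> C0 pC.
have flin : linear (fun x => of_real k C^-1 * p x 0 j : K^o).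
  by move=> a x y; rewrite linearP !mxE mulrDr [RHS]addrC addrC mulrCA.
exists (HB.pack (fun x => of_real k C^-1 * p x 0 j : K^o)
  (GRing.isLinear.Build _ _ _ _ _ flin) : {linear X -> K^o}) => //= x.
rewrite [leLHS]rnormM rnorm_of_real gtr0_norm ?invr_gt0 // ler_pdivrMl //.
exact: le_trans (rnorm_le_l2norm _ _) (pC _).
Qed.

(** Two complemented copies v, v' of l2^n in X and Y, and the tensors
    e_j (x) e_j on them. *)
Section Diagonal.
Variables (X Y : normedModType K) (n : nat) (C : R).
Variables (v : {linear 'rV[K]_n -> X}) (p : {linear X -> 'rV[K]_n}).
Variables (v' : {linear 'rV[K]_n -> Y}) (p' : {linear Y -> 'rV[K]_n}).
Hypotheses (C1 : 1 <= C).
Hypotheses (pK : forall c, p (v c) = c) (p'K : forall c, p' (v' c) = c).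
Hypotheses (vC : forall c, rnorm (v c) <= C * l2norm c)
           (v'C : forall c, rnorm (v' c) <= C * l2norm c).
Hypotheses (pC : forall x, l2norm (p x) <= C * rnorm x)
           (p'C : forall y, l2norm (p' y) <= C * rnorm y).
Variables (alpha : tensor_norm_kind) (Z : normedModType K).
Variable iota : {linear tensor X Y -> Z}.
Hypothesis iota_norm : forall w, (rnorm (iota w))%:E = tensor_norm alpha w.

Definition diagonal (j : 'I_n) : tensor X Y :=
  pure (v (delta_mx 0 j)) (v' (delta_mx 0 j)).

Let C0 : 0 < C. Proof. exact: lt_le_trans ltr01 C1. Qed.

Let delta_l2 j : l2norm (delta_mx 0 j : 'rV[K]_n) = 1.
Proof.
rewrite /l2norm (bigD1 j) //= big1 => [|i ij]; rewrite mxE eqxx /=.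
  by rewrite eqxx addr0 rnorm1 expr1n sqrtr1.
by rewrite (negPf ij) rnorm0 expr0n.
Qed.

Lemma lincomb_diagonalE (c : 'rV[K]_n) : lincomb diagonal c = tensor_class
  [seq (c 0 i *: v (delta_mx 0 i), v' (delta_mx 0 i)) | i <- index_enum 'I_n].
Proof.
by rewrite tensor_class_sum big_map; apply: eq_bigr => i _; rewrite linearZl_LR.
Qed.

Lemma rnorm_diagonal_le j : rnorm (iota (diagonal j)) <= C ^+ 2.
Proof.
rewrite (le_trans (rnorm_pure_le iota_norm _ _)) // expr2.
by rewrite ler_pM ?rnorm_ge0 // (le_trans (vC _), le_trans (v'C _)) ?delta_l2 ?mulr1.
Qed.

Lemma diagonal_coefficient_le (c : 'rV[K]_n) j :
  rnorm (c 0 j : K) <= C ^+ 2 * rnorm (iota (lincomb diagonal c)).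
Proof.
have [f df fE] := coordinate_functional j C0 pC.
have [g dg gE] := coordinate_functional j C0 p'C.
have := rnorm_functional_le iota_norm
  [seq (c 0 i *: v (delta_mx 0 i), v' (delta_mx 0 i)) | i <- index_enum 'I_n] df dg.
rewrite -lincomb_diagonalE big_map.
under eq_bigr => i _ do rewrite [f _]fE [g _]gE linearZ /= pK p'K.
rewrite (bigD1 j) //= big1 => [|i ij]; last first.
  by rewrite !mxE eqxx eq_sym (negPf ij) !mulr0.
rewrite !mxE !eqxx addr0 !mulr1 => h.
rewrite -ler_pdivrMl ?exprn_gt0 //; apply: le_trans h.
rewrite rnormM rnormM !rnorm_of_real gtr0_norm ?invr_gt0 // -exprVn.
by rewrite expr2 mulrAC.
Qed.

(** The two coordinate sequences of a functional f (x) g along the diagonal are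
    in l2, so their product is summable. *)
Lemma injective_diagonal_le (s : 'rV[K]_n) : alpha = Injective -> (forall j, rnorm (s 0 j : K) = 1) ->
  rnorm (iota (lincomb diagonal s)) <= C ^+ 2.
Proof.
move=> aI s1; rewrite -lee_fin iota_norm aI /=.
apply: ge_ereal_sup => _ [f [g [/dual_ballP df /dual_ballP dg ->]]].
rewrite lee_fin.
rewrite lincomb_diagonalE functional_sum_repr big_map.
pose a := \row_j (f (v (delta_mx 0 j)) : K); pose b := \row_j (g (v' (delta_mx 0 j)) : K).
have aC : l2norm a <= C by exact: l2norm_functional_row (ltW C0) df vC.
have bC : l2norm b <= C by exact: l2norm_functional_row (ltW C0) dg v'C.
apply: (le_trans (rnorm_sum _ _ _)).
apply: (@le_trans _ _ (\sum_j rnorm (a 0 j : K) * rnorm (b 0 j : K))).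
  apply: ler_sum => j _; rewrite !mxE linearZ /=.
  by rewrite [leLHS]rnormM [X in X * _]rnormM s1 mul1r.
apply: (@le_trans _ _ (l2norm a * l2norm b)).
  exact: l2_cauchy_schwarz.
by rewrite expr2 ler_pM ?l2norm_ge0.
Qed.

(** The bilinear form sum_j s_j p_j p'_j is bounded on X x Y by the
    Cauchy-Schwarz inequality. *)
Lemma projective_diagonal_ge (s c : 'rV[K]_n) : alpha = Projective ->
    (forall j, rnorm (s 0 j : K) = 1) ->
  rnorm (\sum_j s 0 j * c 0 j : K) <= C ^+ 2 * rnorm (iota (lincomb diagonal c)).
Proof.
move=> aP s1; pose B (x : X) (y : Y) : K^o := \sum_j s 0 j * (p x 0 j * p' y 0 j).
have Bb : bilinear_for *:%R *:%R B.
  split=> [y a x x'|x a y y']; rewrite /B /= linearP scaler_sumr -big_split;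
    apply: eq_bigr => j _; rewrite /= !mxE /GRing.scale /=; ring.
pose b : {bilinear X -> Y -> K^o} :=
  HB.pack B (bilinear_isBilinear.Build K X Y K^o *:%R *:%R B Bb).
have norm w : (rnorm (iota w))%:E = tensor_norm Projective w by rewrite iota_norm aP.
have := @rnorm_projective_le R k X Y Z iota K^o b (C ^+ 2) (lincomb diagonal c) norm.
have -> : tensor_lift b (lincomb diagonal c) = \sum_j s 0 j * c 0 j.
  rewrite linear_sum; apply: eq_bigr => j _; rewrite linearZ /= tensor_lift_pure /=.
  rewrite /B (bigD1 j) //= big1 => [|i ij]; last first.
    by rewrite pK p'K !mxE (negPf ij) andbF !mul0r mulr0.
  by rewrite pK p'K !mxE !eqxx /= !mulr1 addr0 mulrC.
apply; first by rewrite exprn_gt0.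
move=> x y; rewrite /= /B.
apply: (le_trans (rnorm_sum _ _ _)).
apply: (@le_trans _ _ (\sum_j rnorm (p x 0 j : K) * rnorm (p' y 0 j : K))).
  apply: ler_sum => j _; by rewrite [leLHS]rnormM rnormM s1 mul1r.
apply: (@le_trans _ _ (l2norm (p x) * l2norm (p' y))).
  exact: l2_cauchy_schwarz.
apply: (le_trans (ler_pM _ _ (pC x) (p'C y))); rewrite ?l2norm_ge0 //.
by rewrite expr2 mulrACA.
Qed.

(** The diagonal is an l_infty^n for the injective norm and an l_1^n for the
    projective one.  If the identity of l2^m factors through either as A B, then
    m is the trace of A B, at most the product of the Hilbert-Schmidt norms of A
    and B; one of these is O(sqrt n) and the other one, by averaging over signs,
    is bounded. *)
Lemma diagonal_l2_dimension (D : R) m : 0 <= D ->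
  factors_identity D (iota \o lincomb diagonal) m ->
  m%:R ^+ 2 <= n%:R * (C ^+ 2 * D) ^+ 4 :> R.
Proof.
move=> D0 [A [P [PK VD PD]]].
set E := C ^+ 2 * D.
have E0 : 0 <= E by rewrite mulr_ge0 // exprn_ge0 // ltW.
pose B : 'M[K]_(n, m) := \matrix_j P (iota (diagonal j)).
have PB c : P (iota (lincomb diagonal c)) = c *m B.
  rewrite mulmx_sum_row !linear_sum; apply: eq_bigr => j _.
  by rewrite !linearZ /= rowK.
(* P iota and A factor the identity of l2^m through the n coordinates. *)
have AB : A *m B = 1%:M.
  by apply/row_matrixP => i; rewrite !rowE mulmx1 mulmxA -PB; exact: PK.
have sumsq l (r : 'I_l -> 'rV[K]_m) : (forall j, l2norm (r j) <= E) ->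
    \sum_j l2norm (r j) ^+ 2 <= l%:R * E ^+ 2.
  move=> rE; rewrite mulr_natl -[X in _ *+ X]card_ord -sumr_const.
  by apply: ler_sum => j _; rewrite ler_sqr ?nnegrE ?l2norm_ge0.
pose sgn (s : 'I_n -> bool) : 'rV[K]_n := \row_j (-1) ^+ s j.
have sgn1 s j : rnorm (sgn s 0 j : K) = 1.
  rewrite mxE; case: (s j); rewrite ?expr1 ?rnormN ?expr0;
  by rewrite -(rmorph1 (of_real k)) rnorm_of_real normr1.
apply: (le_trans (trace_cauchy_schwarz AB)).
have -> : n%:R * E ^+ 4 = (n%:R * E ^+ 2) * E ^+ 2 by ring.
have sq0 l (r : 'I_l -> 'rV[K]_m) : 0 <= \sum_j l2norm (r j) ^+ 2.
  by apply: sumr_ge0 => j _; exact: sqr_ge0.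
case aE : alpha.
  (* The columns of A are bounded one by one, the rows of B on average. *)
  apply: ler_pM => //.
    apply: sumsq => j; apply: l2norm_dual => // c.
    have -> : \sum_i c 0 i * row j A^T 0 i = (c *m A) 0 j.
      by rewrite mxE; apply: eq_bigr => i _; rewrite !mxE.
    rewrite (le_trans (diagonal_coefficient_le _ _)) // /E -mulrA.
    by rewrite ler_wpM2l ?exprn_ge0 ?(ltW C0) //; exact: VD.
  have [s le] := sign_choice (fun j => row j B).
  apply: (le_trans le); rewrite ler_sqr ?nnegrE ?l2norm_ge0 //.
  have -> : \sum_j (-1) ^+ s j *: row j B = P (iota (lincomb diagonal (sgn s))).
    by rewrite PB mulmx_sum_row; apply: eq_bigr => j _; rewrite mxE.
  rewrite (le_trans (PD _)) // /E mulrC ler_wpM2r //.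
  exact: injective_diagonal_le.
(* Dually, the rows of B are bounded one by one, the columns of A on average. *)
rewrite [leRHS]mulrC; apply: ler_pM => //; last first.
  apply: sumsq => j; rewrite rowK (le_trans (PD _)) // /E mulrC ler_wpM2r //.
  exact: rnorm_diagonal_le.
have [s le] := sign_choice (fun j => row j A^T).
apply: (le_trans le); rewrite ler_sqr ?nnegrE ?l2norm_ge0 //.
apply: l2norm_dual => // c.
have -> : \sum_i c 0 i * (\sum_j (-1) ^+ s j *: row j A^T) 0 i =
          \sum_j sgn s 0 j * (c *m A) 0 j.
  under eq_bigr => i _ do rewrite summxE mulr_sumr.
  rewrite exchange_big; apply: eq_bigr => j _ /=; rewrite !mxE mulr_sumr.
  by apply: eq_bigr => i _; rewrite !mxE; ring.
rewrite (le_trans (projective_diagonal_ge _ aE (sgn1 s))) // /E -mulrA.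
by rewrite ler_wpM2l ?exprn_ge0 ?(ltW C0) //; exact: VD.
Qed.

Lemma diagonal_injective : injective (iota \o lincomb diagonal).
Proof.
move=> c d /= /eqP; rewrite -subr_eq0 -!linearB => /eqP /= e.
apply/eqP; rewrite -subr_eq0; apply/eqP/rowP => j; rewrite [RHS]mxE.
apply: (@rnorm_eq0 R k K); apply/le_anti; rewrite rnorm_ge0 andbT.
by rewrite (le_trans (diagonal_coefficient_le _ _)) // e rnorm0 mulr0.
Qed.

End Diagonal.

(** Otherwise l2 spaces of dimension m >= delta n would be complemented in the
    diagonal for all n, against m = O(sqrt n). *)
Theorem infinite_factors_contradiction alpha (X Y Z : normedModType K)
    (iota : {linear tensor X Y -> Z}) :
    (forall w, (rnorm (iota w))%:E = tensor_norm alpha w) ->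
    ~ finite_dimensional X -> ~ finite_dimensional Y ->
    hilbert_factorization X -> hilbert_factorization Y ->
  ~ hilbert_factorization Z.
Proof.
move=> norm nX nY facX facY [delta [D [delta0 D0 facZ]]].
have [C1 C11 copX] := infinite_l2_copies nX facX.
have [C2 C21 copY] := infinite_l2_copies nY facY.
pose C := Num.max C1 C2.
have C1C : C1 <= C by rewrite le_max lexx.
have C2C : C2 <= C by rewrite le_max lexx orbT.
pose G := (C ^+ 2 * D) ^+ 4.
pose n := (Num.trunc (G / delta ^+ 2 : R)).+1.
have [v [p [pK vC pC]]] := copX n.
have [v' [p' [p'K v'C p'C]]] := copY n.
have wk (a b : R) x : 0 <= x -> a <= b -> a * x <= b * x.
  by move=> x0 ab; rewrite ler_wpM2r.
have C1' : 1 <= C by exact: le_trans C11 C1C.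
have vC' c := le_trans (vC c) (wk _ _ _ (l2norm_ge0 _) C1C).
have v'C' c := le_trans (v'C c) (wk _ _ _ (l2norm_ge0 _) C2C).
have pC' x := le_trans (pC x) (wk _ _ _ (rnorm_ge0 _) C1C).
have p'C' y := le_trans (p'C y) (wk _ _ _ (rnorm_ge0 _) C2C).
have inj := diagonal_injective C1' pK p'K pC' p'C' norm.
have [m dm fm] := facZ n _ inj.
have := diagonal_l2_dimension C1' pK p'K vC' v'C' pC' p'C' norm D0 fm.
rewrite -/G => mG; have n0 : 0 < n%:R :> R by rewrite ltr0n.
have : (delta * n%:R) ^+ 2 <= n%:R * G.
  by apply: le_trans mG; rewrite ler_sqr ?nnegrE ?mulr_ge0 // ltW.
rewrite exprMn expr2 [X in _ * X]expr2 mulrCA ler_pM2l // -expr2.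
rewrite mulrC -ler_pdivlMr ?exprn_gt0 // leNgt => /negP; apply.
exact: truncnS_gt.
Qed.

End InfiniteFactors.

(** * A finite-dimensional factor *)

Section FiniteFactor.
Variables (R : realType) (k : scalar_kind).
Local Notation K := (scalars R k).

Lemma rnorm_complete (Y : completeNormedModType K) (y : nat -> Y) :
  (forall m l, rnorm (y m - y l) <= m.+1%:R^-1 + l.+1%:R^-1) ->
  exists z, forall e : R, 0 < e -> \forall m \near \oo, rnorm (z - y m) < e.
Proof.
move=> yC.
have small (r : R) : 0 < r -> \forall m \near \oo, m.+1%:R^-1 < r.
  by move=> r0; exact: (near_infty_natSinv_lt (PosNum r0)).
have /cauchy_cvgP/cvg_ex[z yz] : cauchy (y @ \oo).
  apply: cauchy_exP => _ /of_real_gt0_ex[r r0 ->].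
  have r20 : 0 < r / 2 by rewrite divr_gt0.
  have [N _ /(_ N (leqnn N)) rN] := small _ r20.
  exists (y N); suff : \forall m \near \oo, ball (y N) (of_real k r) (y m) by [].
  near=> m; rewrite -ball_normE /ball_ /= norm_rnorm ltr_of_real.
  apply: (le_lt_trans (yC N m)); rewrite [ltRHS](splitr r) ltrD //.
  by near: m; exact: small.
exists z => e e0; move/cvgrPdist_lt: yz => /(_ (of_real k e)).
rewrite -(rmorph0 (of_real k)) ltr_of_real => /(_ e0); apply: filterS => m.
by rewrite norm_rnorm ltr_of_real.
Unshelve. all: by end_near. Qed.

Definition bounded_functional (X : normedModType K) (f : X -> K) : Prop :=
  (forall a x y, f (a *: x + y) = a * f x + f y) /\
  exists2 M : R, 0 < M & forall x, rnorm (f x : K) <= M * rnorm x.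

Lemma bounded_functionalD (X : normedModType K) (f g : X -> K) a :
  bounded_functional f -> bounded_functional g ->
  bounded_functional (fun x => f x + a * g x).
Proof.
move=> [fl [M M0 fM]] [gl [N N0 gN]]; split=> [b x y|].
  by rewrite fl gl; ring.
exists (M + rnorm (a : K) * N) => [|x].
  by rewrite ltr_pwDl // mulr_ge0 ?rnorm_ge0 // ltW.
rewrite (le_trans (rnormD _ _)) // mulrDl lerD ?fM // rnormM -mulrA.
by rewrite ler_wpM2l ?rnorm_ge0.
Qed.

Lemma bounded_functional_sum (X : normedModType K) (I : Type) (s : seq I) (P : pred I)
    (F : I -> X -> K) (c : I -> K) : (forall i, bounded_functional (F i)) ->
  bounded_functional (fun x => \sum_(i <- s | P i) c i * F i x).
Proof.
move=> bF; elim: s => [|i s IHs].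
  under eq_fun do rewrite big_nil.
  split=> [a x y|]; first by rewrite mulr0 addr0.
  by exists 1 => // x; rewrite rnorm0 mul1r rnorm_ge0.
under eq_fun do rewrite big_cons.
case: (P i) => //; under eq_fun do rewrite addrC.
exact: bounded_functionalD.
Qed.

(** The dual basis is built one vector at a time: the functional given by the
    Hahn-Banach theorem for the component of e_j outside the span of the earlier
    vectors is corrected so as to vanish on them. *)
Lemma bounded_dual_basis (X : normedModType K) n (e : 'I_n -> X) :
    (forall c : 'I_n -> K, \sum_i c i *: e i = 0 -> forall i, c i = 0) ->
  exists2 F : 'I_n -> X -> K, forall i, bounded_functional (F i) &
    forall i i', F i (e i') = (i == i')%:R.
Proof.
move=> free.
suff dual j : (j <= n)%N -> exists2 F : 'I_n -> X -> K,
    forall i, bounded_functional (F i) &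
    forall i i' : 'I_n, (i < j)%N -> (i' < j)%N -> F i (e i') = (i == i')%:R.
  by have [F bF Fe] := dual n (leqnn n); exists F => // i i'; exact: Fe.
elim: j => [_|j IHj jn].
  exists (fun _ _ => 0) => // i; split=> [a x y|]; first by rewrite mulr0 addr0.
  by exists 1 => // x; rewrite rnorm0 mul1r rnorm_ge0.
have [F bF Fe] := IHj (ltnW jn); pose J := Ordinal jn.
pose y := e J - \sum_(i < n | (i < j)%N) F i (e J) *: e i.
have y0 : y != 0.
  apply/eqP => y0.
  pose c i : K := if i == J then 1 else if (i < j)%N then - F i (e J) else 0.
  suff /free/(_ J)/eqP : \sum_i c i *: e i = 0 by rewrite /c eqxx oner_eq0.
  rewrite (bigD1 J) //= {1}/c eqxx scale1r -[RHS]y0 /y; congr (_ + _).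
  rewrite -sumrN [RHS]big_mkcond [RHS](bigD1 J) //= ltnn add0r.
  apply: eq_bigr => i /negPf iJ; rewrite /c iJ; case: ifP => _; last by rewrite scale0r.
  by rewrite scaleNr.
have [G [G1 Gy]] := hahn_banach y.
have Gy0 : (G y : K) != 0.
  apply: contra y0 => /eqP e0; apply/eqP/rnorm_eq0/le_anti.
  by rewrite rnorm_ge0 andbT (le_trans Gy) // e0 rnorm0.
have bG : bounded_functional (G : X -> K).
  split=> [a x z|]; first by rewrite linearP.
  by exists 1 => // x; rewrite mul1r.
pose H x := G x - \sum_(i < n | (i < j)%N) (G (e i) : K) * F i x.
have bH : bounded_functional H.
  have := bounded_functionalD (-1) bG
    (bounded_functional_sum (index_enum _) (fun i : 'I_n => (i < j)%N) (fun i => G (e i)) bF).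
  by congr bounded_functional; apply: funext => x; rewrite mulN1r.
have He (i : 'I_n) : (i < j)%N -> H (e i) = 0.
  move=> ij; rewrite /H (bigD1 i) //= Fe // eqxx mulr1 big1 ?addr0 ?subrr // => l.
  by move=> /andP[lj li]; rewrite Fe // (negPf li) mulr0.
have HJ : H (e J) = G y.
  rewrite /y linearB linear_sum /H; congr (_ - _); apply: eq_bigr => i _.
  by rewrite linearZ /= mulrC.
pose h x := (G y : K)^-1 * H x.
have bh : bounded_functional h.
  have := bounded_functionalD ((G y : K)^-1 - 1) bH bH.
  congr bounded_functional; apply: funext => x; rewrite /h; ring.
have he (i : 'I_n) : (i < j)%N -> h (e i) = 0 by move=> ij; rewrite /h He ?mulr0.
have hJ : h (e J) = 1 by rewrite /h HJ mulVf.
exists (fun i x => if i == J then h x else F i x + - F i (e J) * h x).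
  by move=> i; case: eqP => // _; exact: bounded_functionalD.
move=> i i'; rewrite !ltnS => ij i'j.
have lt (l : 'I_n) : (l <= j)%N -> l != J -> (l < j)%N.
  by move=> lj; rewrite -(inj_eq val_inj) /= ltn_neqAle lj andbT.
have [->|iJ] := eqVneq i J; have [->|i'J] := eqVneq i' J.
- by rewrite hJ.
- by rewrite he ?lt //.
- by rewrite hJ (negPf iJ) mulr1 subrr.
- by rewrite he ?lt // mulr0 addr0 Fe ?lt.
Qed.

(** Coordinates of a finite-dimensional space, normalised so that the coordinate
    functionals lie in the unit ball of the dual. *)
Lemma finite_dimensional_coordinates (X : normedModType K) : finite_dimensional X ->
  exists n (e : 'I_n -> X) (f : 'I_n -> {linear X -> K^o}),
    (forall i x, rnorm (f i x) <= rnorm x) /\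
    (forall x, x = \sum_i (f i x : K) *: e i).
Proof.
move=> [n [e [free span]]].
have [F bF Fe] := bounded_dual_basis free.
have coord x : x = \sum_i F i x *: e i.
  have : [set: X] x by []. rewrite span => -[c _ <-]; apply: eq_bigr => i _.
  congr (_ *: _); have [Fl _] := bF i.
  pose L := GRing.isLinear.Build K X K^o *:%R (F i : X -> K^o) Fl.
  pose Fi : {linear X -> K^o} := HB.pack (F i : X -> K^o) L.
  have FZ a z : F i (a *: z) = a * F i z by rewrite -[LHS]/(Fi (a *: z)) linearZ.
  rewrite -[F i]/(Fi : X -> K) linear_sum (bigD1 i) //= big1 => [|l li].
    by rewrite FZ Fe eqxx addr0 mulr1.
  by rewrite FZ Fe eq_sym (negPf li) mulr0.
have /choice[M MF] : forall i, exists M : R,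
    0 < M /\ forall x, rnorm (F i x : K) <= M * rnorm x.
  by move=> i; have [_ [M M0 FM]] := bF i; exists M.
have M0 i : 0 < M i by case: (MF i).
have flin i : linear (fun x => of_real k (M i)^-1 * F i x : K^o).
  by move=> a x y; rewrite (bF i).1 mulrDr mulrCA.
pose f i : {linear X -> K^o} := HB.pack (fun x => of_real k (M i)^-1 * F i x : K^o)
  (GRing.isLinear.Build K X K^o *:%R _ (flin i)).
exists n, (fun i => of_real k (M i) *: e i), f.
split=> [i x|x] /=.
  rewrite [leLHS]rnormM rnorm_of_real gtr0_norm ?invr_gt0 // ler_pdivrMl //.
  by case: (MF i).
rewrite {1}[x]coord; apply: eq_bigr => i _; rewrite scalerA mulrAC.
by rewrite -rmorphM mulVf ?gt_eqF // rmorph1 mul1r.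
Qed.

(** Coordinates on X identify the tensor product with a finite power of Y, which
    is already complete. *)
Lemma hilbert_factorization_finite alpha (X Y Z : completeNormedModType K)
    (iota : {linear tensor X Y -> Z}) :
    is_completed_tensor alpha iota -> finite_dimensional X ->
  hilbert_factorization Y -> hilbert_factorization Z.
Proof.
move=> [norm iota_dense] /finite_dimensional_coordinates[n [e [f [f1 coord]]]].
have sl i w : rnorm (slice (f i) w) <= rnorm (iota w).
  exact: (rnorm_slice_le norm w (f1 i)).
have sliceK (w : tensor X Y) : w = \sum_i pure (e i) (slice (f i) w).
  have sliceE i : pure (e i) (slice (f i) w) =
      \sum_(p <- repr w) (f i p.1 : K) *: pure (e i) p.2.
    rewrite -{1}(tensor_reprK w) slice_class linear_sumr.
    by apply: eq_bigr => p _; rewrite linearZr_LR.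
  under eq_bigr => i _ do rewrite sliceE.
  rewrite exchange_big -{1}(tensor_reprK w) tensor_class_sum.
  apply: eq_bigr => p _ /=; rewrite {1}(coord p.1) linear_sumlz.
  by apply: eq_bigr => i _; rewrite linearZl_LR.
have iota_inj : injective iota.
  apply: raddf_inj => w w0; rewrite (sliceK w) big1 // => i _.
  suff -> : slice (f i) w = 0 by rewrite linear0r.
  by apply/rnorm_eq0/le_anti; rewrite rnorm_ge0 andbT (le_trans (sl _ _)) // w0 rnorm0.
have approx z (r : R) : 0 < r -> exists w, rnorm (z - iota w) < r.
  move=> r0; have [||z' [zz' [w _ wz']]] := iota_dense (ball z (of_real k r)).
  - exists z; apply: ballxx.
    by rewrite -(rmorph0 (of_real k)) ltr_of_real.
  - exact: ball_open.
  - by exists w; rewrite wz'; move: zz'; rewrite -ball_normE /ball_ /= norm_rnorm ltr_of_real.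
have E0 : 0 <= \sum_i rnorm (e i) by apply: sumr_ge0 => i _; exact: rnorm_ge0.
(* z is the limit of some iota (w m), whose slices are Cauchy in Y. *)
have iota_surj z : exists w, iota w = z.
  have /choice[w wz] : forall m, exists w, rnorm (z - iota w) < m.+1%:R^-1.
    by move=> m; apply: approx; rewrite invr_gt0.
  have lim i : exists y, forall r : R, 0 < r ->
      \forall m \near \oo, rnorm (y - slice (f i) (w m)) < r.
    apply: rnorm_complete => m l; rewrite -linearB (le_trans (sl _ _)) // linearB /=.
    have -> : iota (w m) - iota (w l) = (z - iota (w l)) - (z - iota (w m)).
      by rewrite opprB [RHS]addrC addrA subrK.
    by rewrite (le_trans (rnormD _ _)) // rnormN addrC lerD // ltW.
  have [y ylim] := choice lim.
  exists (\sum_i pure (e i) (y i)); apply/eqP; rewrite -subr_eq0; apply/eqP/rnorm_eq0.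
  apply/le_anti; rewrite rnorm_ge0 andbT leNgt; apply/negP => d0.
  set d := rnorm _ in d0.
  pose r := d / (1 + \sum_i rnorm (e i)).
  have r0 : 0 < r by rewrite divr_gt0 // ltr_pwDl.
  have small : \forall m \near \oo, m.+1%:R^-1 < r.
    exact: (near_infty_natSinv_lt (PosNum r0)).
  have close : \forall m \near \oo, forall i, rnorm (y i - slice (f i) (w m)) < r.
    by apply: filter_forall => i; exact: ylim.
  have [m _ /(_ m (leqnn m)) [mr yr]] := filterI small close.
  have : d < r + (\sum_i rnorm (e i)) * r.
    have -> : d = rnorm (iota (\sum_i pure (e i) (y i - slice (f i) (w m))) - (z - iota (w m))).
      congr rnorm; rewrite opprB addrA -linearD; congr (iota _ - z).
      rewrite {2}[w m]sliceK -big_split; apply: eq_bigr => i _ /=.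
      by rewrite -linearDr subrK.
    rewrite (le_lt_trans (rnormD _ _)) // rnormN addrC ltr_leD //.
      exact: lt_trans (wz m) mr.
    rewrite linear_sum mulr_suml (le_trans (rnorm_sum _ _ _)) // ler_sum // => i _.
    rewrite (le_trans (rnorm_pure_le norm _ _)) // ler_wpM2l ?rnorm_ge0 //.
    exact: ltW.
  by rewrite -[X in X + _]mul1r -mulrDl mulrC /r divfK ?ltxx // gt_eqF // ltr_pwDl.
have [g gK] := choice iota_surj.
have glin : linear g by move=> a z z'; apply: iota_inj; rewrite linearP !gK.
pose G : {linear Z -> tensor X Y} := HB.pack g (GRing.isLinear.Build _ _ _ _ _ glin).
have alin i : linear (fun y : Y => iota (pure (e i) y)).
  by move=> a y y'; rewrite linearPr linearP.
pose A i : {linear Y -> Z} :=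
  HB.pack (fun y : Y => iota (pure (e i) y)) (GRing.isLinear.Build _ _ _ _ _ (alin i)).
apply: (hilbert_factorization_sum (a := A) (b := fun i => slice (f i) \o G)
         (M := 1 + \sum_i rnorm (e i))) => [|i y|i z|z] /=.
- by rewrite addr_ge0.
- rewrite (le_trans (rnorm_pure_le norm _ _)) // ler_wpM2r ?rnorm_ge0 //.
  rewrite (bigD1 i) //= addrCA lerDl addr_ge0 // sumr_ge0 // => l _.
  exact: rnorm_ge0.
- rewrite (le_trans (sl _ _)) // gK ler_peMl ?rnorm_ge0 //.
  by rewrite lerDl.
- by rewrite -linear_sum -sliceK gK.
Qed.

End FiniteFactor.

(** * Weak Hilbert tensor products *)

Theorem theorem5p13 (R : realType) (k : scalar_kind)
    (X Y : completeNormedModType (scalars R k))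
    (X_neq0 : exists x : X, x != 0) (Y_neq0 : exists y : Y, y != 0)
    (alpha : tensor_norm_kind)
    (Z : completeNormedModType (scalars R k))
    (iota : {linear tensor X Y -> Z})
    (Z_completion : is_completed_tensor alpha iota) :
  weak_hilbert Z <->
  (finite_dimensional X /\ weak_hilbert Y) \/
  (finite_dimensional Y /\ weak_hilbert X).
Proof.
have Z_completion' := is_completed_tensor_swap Z_completion.
rewrite !weak_hilbertP; split=> [facZ|].
  have facY : hilbert_factorization Y.
    by have [x x0] := X_neq0; exact: hilbert_factorization_factor x0 Z_completion facZ.
  have facX : hilbert_factorization X.
    by have [y y0] := Y_neq0; exact: hilbert_factorization_factor y0 Z_completion' facZ.
  have [fX|nX] := pselect (finite_dimensional X); first by left.
  have [fY|nY] := pselect (finite_dimensional Y); first by right.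
  by case: (infinite_factors_contradiction Z_completion.1 nX nY facX facY facZ).
case=> -[fin fac]; first exact: hilbert_factorization_finite Z_completion fin fac.
exact: hilbert_factorization_finite Z_completion' fin fac.
Qed.
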